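(* Let $1\le p\le\infty$. Suppose that $f,g:\mathbb{R}\to\mathbb{R}$ satisfy $|g(x)|\le k_1|x|+k_2$ and $|f(x)|\le c_1|x|+c_2$ for all $x\in\mathbb{R}$ with nonnegative constants $k_1,k_2,c_1,c_2$ such that $k_1\beta c_1<1$, and that $g\in C^1(\mathbb{R})$ with $|g'(x)|\le k_3|x|+k_4$ for all $x\in\mathbb{R}$ and some nonnegative constants $k_3,k_4$. Assume in addition that $g$ and $f$ are monotonic (nondecreasing) and Lipschitz continuous on bounded sets with Lipschitz constants $N$ and $M$, respectively. Let $u$ be the solution of the Cauchy problem $\partial_t u=-u+F(u)$ with initial condition $u(\cdot,0)$, and let $v(x,t)$ [respectively $V(x,t)$] be a subsolution [respectively super solution] of this Cauchy problem with initial condition $u(\cdot,0)$. Then $$v(x,t)\le u(x,t)\le V(x,t)\quad\text{almost everywhere.}$$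
   Context: $\Omega\subset\mathbb{R}^N$ ($N\ge1$; the dimension is unrelated to the Lipschitz constant also called $N$) is a bounded smooth domain; $h,\beta\ge 0$ are constants. $J$ is a nonnegative symmetric function of class $C^1$ on $\mathbb{R}^N\times\mathbb{R}^N$ with $\int_{\mathbb{R}^N}J(x,y)\,dy=\int_{\mathbb{R}^N}J(x,y)\,dx=1$, and $Kw(x)=\int_{\mathbb{R}^N}J(x,y)w(y)\,dy$. The phase space is $X=\{u\in L^p(\mathbb{R}^N): u(x)=0 \text{ for } x\in\mathbb{R}^N\setminus\Omega\}$ with the norm of $L^p(\mathbb{R}^N)$, identified with $L^p(\Omega)$; functions on $\Omega$ are extended by $0$ outside $\Omega$. The map $F:X\to X$ is $F(u)(x)=g(\beta K(f\circ u)(x)+\beta h)$ for $x\in\Omega$ and $F(u)(x)=0$ for $x\in\mathbb{R}^N\setminus\Omega$. A function $v(x,t)$ is a subsolution of the Cauchy problem for $\partial_t u=-u+F(u)$ with initial condition $u(\cdot,0)$ if $v(x,0)\le u(x,0)$ for almost all $x\in\Omega$, $v$ is continuously differentiable with respect to $t$, and $\frac{\partial v(x,t)}{\partial t}\le -v(x,t)+g(\beta K(f\circ v(\cdot,t))(x)+\beta h)$ almost everywhere. A super solution $V(x,t)$ has the same regularity, satisfies the reversed differential inequality, and $V(x,0)\ge u(x,0)$ for almost all $x\in\Omega$. *)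

(* Defs.v *)
From HB Require Import structures.
From mathcomp Require Import all_boot all_order all_algebra.
From mathcomp Require Import all_classical all_reals all_analysis.

Set Implicit Arguments.
Unset Strict Implicit.
Unset Printing Implicit Defensive.

Import Order.TTheory GRing.Theory Num.Theory.
Import numFieldNormedType.Exports.

Local Open Scope classical_set_scope.
Local Open Scope ring_scope.

(** * Lebesgue measure on R^n

    R^n is ['rV[R]_n], with the sigma-algebra generated by the coordinates, as
    the library does for [n.-tuple R]; it is the Borel sigma-algebra. *)

Fact rV_display : measure_display. Proof. exact: default_measure_display. Qed.

Section measurable_rV.
Context {R : realType} {n : nat}.

Definition rV_coord (i : 'I_n) (v : 'rV[R]_n) : measurableTypeR R := v ord0 i.

Let rV_set0 : g_sigma_preimage rV_coord set0.
Proof. exact: sigma_algebra0. Qed.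

Let rV_setC A : g_sigma_preimage rV_coord A -> g_sigma_preimage rV_coord (~` A).
Proof. exact: sigma_algebraC. Qed.

Let rV_bigcup (F : (set 'rV[R]_n)^nat) :
  (forall i, g_sigma_preimage rV_coord (F i)) ->
  g_sigma_preimage rV_coord (\bigcup_i (F i)).
Proof. exact: sigma_algebra_bigcup. Qed.

HB.instance Definition _ := @isMeasurable.Build rV_display 'rV[R]_n
  (g_sigma_preimage rV_coord) rV_set0 rV_setC rV_bigcup.

Lemma measurable_rV_coord i : measurable_fun setT (rV_coord i).
Proof.
move=> _ Y mY; rewrite setTI; apply: sub_sigma_algebra => /=.
rewrite -bigcup_seq/=; exists i => /=; first by rewrite mem_index_enum.
by exists Y => //; rewrite setTI.
Qed.

Lemma measurable_fun_rVP d (T : measurableType d) (f : T -> 'rV[R]_n) :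
  (forall i, measurable_fun setT (rV_coord i \o f)) -> measurable_fun setT f.
Proof.
move=> mf; apply: (@iffRL _ (g_sigma_preimage (fun i => rV_coord i \o f) `<=`
  measurable)).
  split=> [+|]; last first.
    rewrite g_sigma_preimage_comp => H _ A mA; rewrite setTI; apply: H.
    by exists A => //; rewrite setTI.
  by move=> + A; rewrite g_sigma_preimage_comp => H [B mB <-]; exact: H.
apply: smallest_sub; first exact: sigma_algebra_measurable.
rewrite -bigcup_seq => A [i _ [B mB <-]].
exact: mf.
Qed.

End measurable_rV.

Definition rV_cons {R : realType} {n : nat} (z : measurableTypeR R * 'rV[R]_n) :
  'rV[R]_n.+1 := row_mx (z.1 : R)%:M z.2.

Lemma rV_coord_cons0 {R : realType} {n : nat}
    (z : measurableTypeR R * 'rV[R]_n) : rV_coord ord0 (rV_cons z) = z.1.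
Proof.
rewrite /rV_coord /rV_cons.
rewrite (_ : ord0 = lshift n (ord0 : 'I_1)); last exact: val_inj.
by apply: etrans (row_mxEl _ _ _ _) _; rewrite mxE eqxx mulr1n.
Qed.

Lemma rV_coord_consS {R : realType} {n : nat} (i : 'I_n)
    (z : measurableTypeR R * 'rV[R]_n) :
  rV_coord (lift ord0 i) (rV_cons z) = rV_coord i z.2.
Proof.
rewrite /rV_coord /rV_cons.
rewrite (_ : lift ord0 i = rshift 1 i); last exact: val_inj.
exact: row_mxEr.
Qed.

Definition rV_uncons {R : realType} {n : nat} (v : 'rV[R]_n.+1) :
    measurableTypeR R * 'rV[R]_n :=
  (rV_coord ord0 v, \row_i rV_coord (lift ord0 i) v).

Lemma rV_consK {R : realType} {n : nat} : cancel (@rV_cons R n) rV_uncons.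
Proof.
move=> z; rewrite [RHS]surjective_pairing /rV_uncons rV_coord_cons0.
by congr pair; apply/rowP => i; rewrite mxE rV_coord_consS.
Qed.

Lemma rV_unconsK {R : realType} {n : nat} : cancel rV_uncons (@rV_cons R n).
Proof.
move=> v; apply/rowP => j; rewrite -/(rV_coord _ _).
have [i ->|->] := unliftP ord0 j; last by rewrite rV_coord_cons0.
by rewrite rV_coord_consS /rV_coord mxE.
Qed.

Lemma measurable_rV_cons {R : realType} {n : nat} :
  measurable_fun setT (@rV_cons R n).
Proof.
apply: measurable_fun_rVP => j; have [i ->|->] := unliftP ord0 j.
  rewrite (_ : _ \o _ = rV_coord i \o snd); last first.
    by apply/funext => z /=; rewrite rV_coord_consS.
  by apply: measurableT_comp => //; exact: measurable_rV_coord.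
rewrite (_ : _ \o _ = fst) //.
by apply/funext => z /=; rewrite rV_coord_cons0.
Qed.

Lemma measurable_rV_uncons {R : realType} {n : nat} :
  measurable_fun setT (@rV_uncons R n).
Proof.
apply/measurable_fun_pairP; split; first exact: measurable_rV_coord.
apply: measurable_fun_rVP => i.
rewrite (_ : _ \o _ = rV_coord (lift ord0 i)); first exact: measurable_rV_coord.
by apply/funext => v; rewrite /= /rV_coord mxE.
Qed.

Section lebesgue_rV_succ.
Context {R : realType} {n : nat}.
Variable m : {sigma_finite_measure set 'rV[R]_n -> \bar R}.
Local Open Scope ereal_scope.

Definition leb_succ : set 'rV[R]_n.+1 -> \bar R :=
  pushforward (@lebesgue_measure R \x m) rV_cons.

Let leb_succ0 : leb_succ set0 = 0.
Proof. by rewrite /leb_succ /pushforward preimage_set0 measure0. Qed.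

Let leb_succ_ge0 A : 0 <= leb_succ A.
Proof. by rewrite /leb_succ /pushforward; exact: measure_ge0. Qed.

Let leb_succ_sigma_additive : semi_sigma_additive leb_succ.
Proof.
move=> F mF tF mUF; rewrite /leb_succ /pushforward preimage_bigcup.
have mp A : measurable A -> measurable (@rV_cons R n @^-1` A).
  by move=> mA; rewrite -[X in measurable X]setTI; exact: measurable_rV_cons.
apply: measure_semi_sigma_additive.
- by move=> i; exact: mp.
- apply/trivIsetP => /= i j _ _ ij; rewrite -preimage_setI.
  by move/trivIsetP : tF => /(_ _ _ _ _ ij) ->//; rewrite preimage_set0.
- by rewrite -preimage_bigcup; exact: mp.
Qed.

HB.instance Definition _ := isMeasure.Build _ _ _ leb_succ
  leb_succ0 leb_succ_ge0 leb_succ_sigma_additive.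

Let leb_succ_sigma_finite : sigma_finite setT leb_succ.
Proof.
have /sigma_finiteP[F [FT ndF Foo]] := sigma_finiteT (@lebesgue_measure R).
have /sigma_finiteP[G [GT ndG Goo]] := sigma_finiteT m.
exists (fun i => rV_uncons @^-1` (F i `*` G i)).
  rewrite -preimage_bigcup [X in _ @^-1` X](_ : _ = setT) ?preimage_setT//.
  rewrite -setXTT FT GT predeqE => -[x y]; split=> [[i _ []/= ? ?]|].
    by split; exists i.
  move=> [/= [i _ Fix] [k _ Gky]]; exists (maxn i k) => //; split.
  - by move: x Fix; exact/subsetPset/ndF/leq_maxl.
  - by move: y Gky; exact/subsetPset/ndG/leq_maxr.
move=> k; have [mF Fk] := Foo k; have [mG Gk] := Goo k; split.
  rewrite -[X in measurable X]setTI; apply: measurable_rV_uncons => //.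
  exact: measurableX.
rewrite /leb_succ /pushforward -comp_preimage (_ : _ \o _ = id) ?preimage_id.
  by rewrite product_measure1E// lte_mul_pinfty// ge0_fin_numE.
by apply/funext => z /=; rewrite rV_consK.
Qed.

HB.instance Definition _ := Measure_isSigmaFinite.Build _ _ _ leb_succ
  leb_succ_sigma_finite.

End lebesgue_rV_succ.

(** [leb n.+1] is the image of [lebesgue_measure \x leb n] under
    [R * R^n ~ R^n.+1]; see [leb_box] for its value on boxes. *)
Fixpoint leb {R : realType} (n : nat) :
    {sigma_finite_measure set 'rV[R]_n -> \bar R} :=
  match n with
  | 0 => dirac (0 : 'rV[R]_0)
  | n'.+1 => leb_succ (leb n')
  end.

Lemma leb_box {R : realType} (n : nat) (a b : 'I_n -> R) :
  (forall i, a i <= b i) ->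
  leb n [set v | forall i, v ord0 i \in `[a i, b i] ] =
    (\prod_(i < n) (b i - a i))%:E.
Proof.
elim: n a b => [|n IH] a b ab.
  by rewrite big_ord0 /= diracE mem_set// => -[].
rewrite /= /leb_succ /pushforward.
set B' := [set v : 'rV[R]_n |
  forall i, v ord0 i \in `[a (lift ord0 i), b (lift ord0 i)] ].
have -> : rV_cons @^-1` [set v | forall i, v ord0 i \in `[a i, b i] ] =
  [set` `[a ord0, b ord0] ] `*` B'.
  apply/seteqP; split=> [z zab|z [z1 z2] j] /=.
    split; first by have := zab ord0; rewrite -/(rV_coord _ _) rV_coord_cons0.
    by move=> i; have := zab (lift ord0 i);
      rewrite -/(rV_coord _ _) rV_coord_consS.
  have [i ->|->] := unliftP ord0 j.
    by rewrite -/(rV_coord _ _) rV_coord_consS; exact: z2.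
  by rewrite -/(rV_coord _ _) rV_coord_cons0; exact: z1.
have mB' : measurable B'.
  have -> : B' = \bigcap_(i in [set: 'I_n])
      (rV_coord i @^-1` [set` `[a (lift ord0 i), b (lift ord0 i)] ]).
    by apply/seteqP; split=> v Bv i; [move=> _; exact: Bv|exact: Bv].
  apply: fin_bigcap_measurable => // i _.
  by rewrite -[X in measurable X]setTI; exact: measurable_rV_coord.
rewrite product_measure1E// IH//.
rewrite [X in (X * _)%E](_ : _ = lebesgue_measure (`[a ord0, b ord0] : set R)%classic)//.
rewrite lebesgue_measure_itv/= lte_fin big_ord_recl.
have := ab ord0; rewrite le_eqVlt => /orP[/eqP ->|->].
  by rewrite ltxx subrr mul0r mul0e.
by rewrite -EFinD -EFinM.
Qed.

(** * C^k functions and smooth domains *)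

(** [V] is meant to be finite-dimensional: there, continuity of [z |-> 'd f z v]
    for every fixed [v] is continuity of [z |-> 'd f z] in operator norm. *)
Fixpoint Ck {R : realType} {V : normedModType R} (k : nat) (f : V -> R) : Prop :=
  match k with
  | 0 => continuous f
  | k'.+1 => (forall z, differentiable f z) /\
             (forall v, Ck k' (fun z => 'd f z v))
  end.

(** Near each boundary point [Omega] is the sublevel set [phi < 0] of a smooth
    function with non-vanishing differential (so [Omega] lies on one side of
    its boundary, which is locally the hypersurface [phi = 0]). *)
Definition smooth_boundary {R : realType} {V : normedModType R} (Omega : set V) :=
  forall z, (closure Omega `\` interior Omega) z ->
  exists phi : V -> R, [/\ forall k, Ck k phi, exists v, 'd phi z v != 0 &
    \forall x \near z, Omega x <-> phi x < 0].

Definition bounded_smooth_domain {R : realType} {V : normedModType R}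
    (Omega : set V) :=
  [/\ Omega !=set0, open Omega, connected Omega, bounded_set Omega &
      smooth_boundary Omega].

(** * The nonlocal evolution equation *)

Section nonlocal_evolution.
Context {R : realType} {n : nat}.
Implicit Types (J : 'rV[R]_n -> 'rV[R]_n -> R) (w : 'rV[R]_n -> R).
Implicit Types (p : \bar R) (Omega : set 'rV[R]_n) (f g : R -> R) (beta h : R).
(* a function v(x, t) of space and time is written [v t x] *)
Implicit Types (v : R -> 'rV[R]_n -> R).

Definition symmetric_probability_kernel J :=
  [/\ Ck 1 (fun z : 'rV[R]_n * 'rV[R]_n => J z.1 z.2),
      forall x y, 0 <= J x y, forall x y, J x y = J y x,
      forall x, (\int[leb n]_y (J x y)%:E)%E = 1%E &
      forall y, (\int[leb n]_x (J x y)%:E)%E = 1%E].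

Definition Kop J w : 'rV[R]_n -> R := fun x => \int[leb n]_y (J x y * w y).

(** Elements of the phase space are represented by functions, so equalities and
    inequalities between them are to be read almost everywhere. *)
Definition phase_space p Omega : set ('rV[R]_n -> R) :=
  [set w | w \in Lfun (leb n) p /\ forall x, ~ Omega x -> w x = 0].

Definition reaction J beta h f g w : 'rV[R]_n -> R :=
  fun x => g (beta * Kop J (f \o w) x + beta * h).

Definition Fop Omega J beta h f g w : 'rV[R]_n -> R :=
  reaction J beta h f g w \_ Omega.

Definition Xnorm p w : \bar R := 'N[leb n]_p [EFin \o w].

(** [v] is of class C^1 from [0, +oo[ to the phase space, with time derivative
    [v'] (one-sided at time 0). *)
Definition C1_phase_space p Omega v v' :=
  [/\ forall t, 0 <= t -> phase_space p Omega (v t),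
      forall t, 0 <= t -> phase_space p Omega (v' t),
      forall t, 0 <= t ->
        Xnorm p (fun x => (s - t)^-1 * (v s x - v t x) - v' t x)
          @[s --> within [set s | 0 <= s /\ s != t] (nbhs t)] --> 0%E &
      forall t, 0 <= t ->
        Xnorm p (fun x => v' s x - v' t x)
          @[s --> within [set s | 0 <= s] (nbhs t)] --> 0%E].

Definition is_solution p Omega J beta h f g (u0 : 'rV[R]_n -> R) u :=
  {ae leb n, forall x, u 0 x = u0 x} /\
  exists2 u', C1_phase_space p Omega u u' &
    forall t, 0 <= t ->
      {ae leb n, forall x, u' t x = - u t x + Fop Omega J beta h f g (u t) x}.

Definition is_subsolution p Omega J beta h f g (u0 : 'rV[R]_n -> R) v :=
  {ae leb n, forall x, Omega x -> v 0 x <= u0 x} /\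
  exists2 v', C1_phase_space p Omega v v' &
    forall t, 0 <= t ->
      {ae leb n, forall x, Omega x ->
        v' t x <= - v t x + reaction J beta h f g (v t) x}.

Definition is_supersolution p Omega J beta h f g (u0 : 'rV[R]_n -> R) v :=
  {ae leb n, forall x, Omega x -> u0 x <= v 0 x} /\
  exists2 v', C1_phase_space p Omega v v' &
    forall t, 0 <= t ->
      {ae leb n, forall x, Omega x ->
        - v t x + reaction J beta h f g (v t) x <= v' t x}.

End nonlocal_evolution.

(* Main.v *)
Require Import Defs.
From mathcomp Require Import all_boot all_order all_algebra.
From mathcomp Require Import all_classical all_reals all_analysis.
From mathcomp Require Import measurable_realfun ess_sup_inf.
From mathcomp Require Import ring lra.

(** Let [u] be the solution, [v] a subsolution and [w = v - u]. Since [F] is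
    monotone, one would like to bound the positive part of [w] by Gronwall's
    lemma, but [u] and [v] are only in L^p: [f] is evaluated on an unbounded set
    and need not be Lipschitz there, so [f (v t) - f (u t)] is not controlled
    by a constant times [w t]. The theorem holds nevertheless, because [u]
    crosses the region where [f] may be steep too fast for it to matter.

    The exponent disappears first: [Omega] is bounded, so everything takes place
    in L^1 (Omega). Suppose that [w t <= delta] almost everywhere for all [t] in
    some time interval. The kernel [J] is bounded on [Omega * Omega] and the
    argument of [g] stays in a bounded set, so
    [w' t <= - w t + K * psi t], where [psi t] is the integral over [Omega] of
    [f (u t + delta) - f (u t)] ([kernel_increment_le], [subsolution_le]).
    It suffices to show that the integral of [psi] over a short time
    interval is at most a small multiple of [delta]; then [w t <= delta / 2],
    and iterating gives [w t <= 0] on that interval.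

    Split [f] at the levels [- L] and [L] ([increment_split]). The part between
    these levels is Lipschitz, and contributes at most a constant times [delta]
    times the length of the interval. As for the part above [L], the reaction
    term is bounded by some [c], so [u] decreases at a speed of about
    [L / 2] or more where it is larger than [L]. Therefore [u t + delta] is at
    most [u (t - tau)] there, for [tau = 2 * delta / L] ([above_shift]). So the
    contribution of this part to [psi t] is at most [Z (t - tau) - Z t], where
    [Z] is the integral of the upper part of [f] along the solution. Summed over
    a time grid of mesh [tau] these differences telescope, and the result is at
    most a constant times [tau], that is, a constant times [delta / L]. The part
    below [- L] is similar, with [t + tau] instead of [t - tau] since [u]
    increases there ([below_shift]). Choose [L] large, then the interval short
    ([halved_bound]). The length of the interval is uniform up to any given
    time, so finitely many intervals reach it ([comparison]).

    Elements of the phase space are classes of functions, chosen separately for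
    each time, so no derivative in time at a fixed point of [Omega] is
    available. All the differential inequalities used have constant
    coefficients on each interval of the grid, and they are integrated over
    measurable subsets of [Omega], which reduces them to scalar ones
    ([L1_linear_decay]). The constants are allowed to depend on the interval
    of the grid, so no integral in time is needed either.

    The statement on supersolutions follows by reflection: [- V] is a
    subsolution for the functions [fun z => - f (- z)] and
    [fun z => - g (- z)] ([supersolution_ge]). *)

Set Implicit Arguments.
Unset Strict Implicit.
Unset Printing Implicit Defensive.

Import Order.TTheory GRing.Theory Num.Theory.
Import numFieldNormedType.Exports.

Local Open Scope classical_set_scope.
Local Open Scope ring_scope.

(** * Derivatives on the half-line *)

Notation punctured_half_line t :=
  (within [set s | 0 <= s /\ s != t] (nbhs t)) (only parsing).

Section half_line_derivative.
Context {R : realType}.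
Implicit Types (phi : R -> R) (a b c l t : R).

(** The derivative is two-sided at positive times and one-sided at time 0. *)
Definition half_line_derivative phi t l :=
  (s - t)^-1 * (phi s - phi t) @[s --> punctured_half_line t] --> l.

Lemma half_line_derivative_is_derive phi t l :
  0 < t -> half_line_derivative phi t l -> is_derive t 1 phi l.
Proof.
move=> t0 dphi.
have to_t : (fun h : R => h + t) @ 0^' --> punctured_half_line t.
  move=> P /= /nbhs_ballP[e /= e0 eP].
  have m0 : 0 < Num.min e t by rewrite lt_min e0.
  apply/nbhs_ballP; exists (Num.min e t) => //= h.
  rewrite /ball /= sub0r normrN lt_min => /andP[he ht] h0.
  apply: eP.
    by rewrite /ball /= opprD addrCA subrr addr0 normrN.
  split; last by rewrite -subr_eq0 addrK.
  by move: ht; rewrite ltr_norml => /andP[]; lra.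
suff cv : h^-1 *: ((phi \o shift t) (h *: (1 : R)) - phi t) @[h --> 0^'] --> l.
  by apply: DeriveDef; [apply: cvgP cv | exact: cvg_lim cv].
have := cvg_comp _ _ to_t dphi; apply: cvg_trans.
apply: near_eq_cvg; near=> h.
by rewrite /= addrK scaler1.
Unshelve. all: by end_near. Qed.

Lemma half_line_derivative_continuous phi t l :
  half_line_derivative phi t l ->
  phi s @[s --> within [set s | 0 <= s] (nbhs t)] --> phi t.
Proof.
move=> /cvgrPdist_lt/(_ 1 ltr01); rewrite near_withinE.
move=> dphi; apply/cvgrPdist_lt => e e0.
rewrite near_withinE; near=> s => s0.
have [->|st] := eqVneq s t; first by rewrite subrr normr0.
have : `|l - (s - t)^-1 * (phi s - phi t)| < 1.
  by apply: (near dphi s).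
set q := _ * _ => lq.
have -> : phi t - phi s = - ((s - t) * q).
  by rewrite /q mulrA divff ?mul1r ?opprB // subr_eq0.
have q1 : `|q| <= `|l| + 1.
  rewrite (_ : q = l - (l - q)); last by ring.
  by rewrite (le_trans (ler_normB _ _)) // lerD2l ltW.
rewrite normrN normrM.
have l1 : 0 < `|l| + 1 by rewrite ltr_wpDl.
have st' : `|s - t| < e / (`|l| + 1).
  rewrite distrC; near: s; apply/nbhs_ballP.
  by exists (e / (`|l| + 1)) => //=; rewrite divr_gt0.
apply: (@le_lt_trans _ _ (`|s - t| * (`|l| + 1))).
  by rewrite ler_wpM2l.
by rewrite -ltr_pdivlMr.
Unshelve. all: by end_near. Qed.

(** The derivative of [fun t => expR t * (phi t - c)] is nonpositive. *)
Lemma linear_decay phi phi' a b c : 0 <= a -> a <= b ->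
  (forall t, a <= t <= b -> half_line_derivative phi t (phi' t)) ->
  (forall t, a <= t <= b -> phi' t <= - phi t + c) ->
  expR (b - a) * phi b <= phi a + (expR (b - a) - 1) * c.
Proof.
move=> a0 ab dphi phic.
pose y t := expR t * (phi t - c).
have dy t : a < t < b -> is_derive t 1 y (expR t * (phi' t + (phi t - c))).
  move=> /andP[at_ tb].
  have dt : is_derive t 1 phi (phi' t).
    apply: half_line_derivative_is_derive; first exact: le_lt_trans at_.
    by apply: dphi; rewrite !ltW.
  apply: is_derive_eq; rewrite subr0 /GRing.scale /=; ring.
have cy : {within `[a, b], continuous y}.
  apply/subspace_continuousP => t; rewrite /= in_itv /= => tab.
  apply: cvgM.
    apply: cvg_within_filter; exact: continuous_expR.
  apply: cvgB; last exact: cvg_cst.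
  apply: cvg_trans (half_line_derivative_continuous (dphi t tab)).
  apply: cvg_app => P; rewrite /nbhs /= /within /= => nP.
  apply: filterS nP => s + sab.
  by apply; move: sab; rewrite /= in_itv /= => /andP[/(le_trans a0)].
have : y b <= y a.
  apply: (@ler0_derive1_nincr _ y a b) => //.
  - move=> t; rewrite in_itv /= => tab; by case: (dy t tab).
  - move=> t; rewrite in_itv /= => tab; rewrite derive1E.
    have [_ ->] := dy t tab.
    rewrite pmulr_rle0 ?expR_gt0 //.
    have /phic : a <= t <= b by case/andP: tab => /ltW -> /ltW ->.
    by lra.
rewrite /y => yab.
have ea : expR a * expR (- a) = 1 by rewrite -expRD subrr expR0.
have := ler_wpM2r (expR_ge0 (- a)) yab.
rewrite expRD mulrAC => yab'.
have {}ea2 : expR a * (phi a - c) * expR (- a) = phi a - c.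
  by rewrite mulrAC ea mul1r.
by move: yab'; rewrite ea2; lra.
Qed.

End half_line_derivative.

(** * Integrals over a set of finite measure *)

Section integrals.
Context d (T : measurableType d) (R : realType).
Variables (mu : {measure set T -> \bar R}) (D : set T).
Hypotheses (mD : measurable D) (Dfin : (mu D < +oo)%E).
Local Notation L1 f := (mu.-integrable D (EFin \o f)).
Implicit Types f g w : T -> R.

Lemma L1_measurable f : L1 f -> measurable_fun D f.
Proof. by move=> /measurable_int/measurable_EFinP. Qed.

Lemma L1_cst (c : R) : L1 (cst c).
Proof.
apply: measurable_bounded_integrable => //.
exists `|c|; split; first exact: num_real.
by move=> x cx y _; exact: ltW.
Qed.

Lemma L1D f g : L1 f -> L1 g -> L1 (fun x => f x + g x).
Proof. by move=> If Ig; apply: eq_integrable (integrableD mD If Ig). Qed.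

Lemma L1B f g : L1 f -> L1 g -> L1 (fun x => f x - g x).
Proof. by move=> If Ig; apply: eq_integrable (integrableB mD If Ig). Qed.

Lemma L1Z (c : R) f : L1 f -> L1 (fun x => c * f x).
Proof. by move=> If; apply: eq_integrable (integrableZl mD c If). Qed.

Lemma L1N f : L1 f -> L1 (fun x => - f x).
Proof. by move=> If; apply: eq_integrable (integrableN If). Qed.

Lemma L1_norm f : L1 f -> L1 (fun x => `|f x|).
Proof. by move=> /integrable_norm. Qed.

Lemma L1_dominated f g : measurable_fun D f -> L1 g ->
  (forall x, D x -> `|f x| <= g x) -> L1 f.
Proof.
move=> mf Ig fg; apply: le_integrable Ig => //; first exact/measurable_EFinP.
by move=> x Dx /=; rewrite lee_fin (le_trans (fg x Dx)) // ler_norm.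
Qed.

Lemma L1_affine (a b : R) w : L1 w -> L1 (fun x => a * `|w x| + b).
Proof. by move=> Iw; apply: L1D; [apply/L1Z/L1_norm | exact: L1_cst]. Qed.

Lemma Rintegral_affine (a b : R) w : L1 w ->
  \int[mu]_(x in D) (a * `|w x| + b)
  = a * (\int[mu]_(x in D) `|w x|) + b * fine (mu D).
Proof.
move=> Iw; rewrite RintegralD //; [|exact/L1Z/L1_norm|exact: L1_cst].
by rewrite RintegralZl ?Rintegral_cst //; exact: L1_norm.
Qed.

Lemma L1_comp_linear_growth (g : R -> R) (a b : R) w :
  measurable_fun setT g -> (forall x, `|g x| <= a * `|x| + b) -> L1 w ->
  L1 (g \o w).
Proof.
move=> mg gab Iw; apply: L1_dominated (L1_affine a b Iw) _ => [|x _] /=.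
  by apply: measurableT_comp mg _; exact: L1_measurable.
exact: gab.
Qed.

Lemma ae_le_Rintegral f g : L1 f -> L1 g ->
  {ae mu, forall x, D x -> f x <= g x} ->
  \int[mu]_(x in D) f x <= \int[mu]_(x in D) g x.
Proof.
move=> If Ig fg; rewrite -subr_ge0 -RintegralB //.
have Igf := L1B Ig If.
rewrite (_ : Rintegral _ _ _ = \int[mu]_(x in D) `|g x - f x|); last first.
  congr fine; apply: ae_eq_integral => //.
  - exact: measurable_int Igf.
  - exact: measurable_int (L1_norm Igf).
  - apply: filterS fg => x + Dx => /(_ Dx) fgx /=.
    by rewrite ger0_norm ?subr_ge0.
exact: Rintegral_ge0.
Qed.

Lemma Rintegral_subset (A : set T) f : measurable A -> A `<=` D -> L1 f ->
  (forall x, D x -> 0 <= f x) ->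
  \int[mu]_(x in A) f x <= \int[mu]_(x in D) f x.
Proof.
move=> mA AD If f0.
have IfA : mu.-integrable A (EFin \o f) by exact: integrableS If.
apply: fine_le; [exact: integrable_fin_num|exact: integrable_fin_num|].
by apply: ge0_subset_integral => //; exact: measurable_int If.
Qed.

(** On the set where [f] is positive its integral is both nonnegative and
    nonpositive, so this set is null. *)
Lemma ae_le0_Rintegral f : L1 f ->
  (forall A, measurable A -> A `<=` D -> \int[mu]_(x in A) f x <= 0) ->
  {ae mu, forall x, D x -> f x <= 0}.
Proof.
move=> If f_le0.
pose A := D `&` [set x | 0 < f x].
have mA : measurable A.
  rewrite (_ : A = D `&` f @^-1` `]0, +oo[); last first.
    by apply/seteqP; split=> x [Dx]; rewrite /= in_itv /= andbT.
  by apply: (L1_measurable If).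
have AD : A `<=` D by move=> x [].
have IfA : mu.-integrable A (EFin \o f) by exact: integrableS If.
have f0 : (\int[mu]_(x in A) `|(f x)%:E| = 0)%E.
  have -> : (\int[mu]_(x in A) `|(f x)%:E| = (\int[mu]_(x in A) f x)%:E)%E.
    rewrite fineK; last exact: integrable_fin_num.
    apply: eq_integral => x; rewrite inE => -[_ /= fx].
    by rewrite ger0_norm // ltW.
  apply/eqP; rewrite eqe eq_le f_le0 //=.
  by apply: Rintegral_ge0 => x [_ /= /ltW].
have /(ae_eq_integral_abs _ mA (measurable_int _ IfA)) := f0.
apply: filterS => x fA Dx; rewrite leNgt; apply/negP => fx.
have [] : (f x)%:E = 0%E by apply: fA.
by move=> fx0; rewrite fx0 ltxx in fx.
Qed.

End integrals.

(** * Curves that are differentiable in L^1 *)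

Section L1_curves.
Context d (T : measurableType d) (R : realType).
Variables (mu : {measure set T -> \bar R}) (D : set T).
Hypotheses (mD : measurable D) (Dfin : (mu D < +oo)%E).
Local Notation L1 f := (mu.-integrable D (EFin \o f)).
Implicit Types w : R -> T -> R.

(** The curve is differentiable in L^1 only: nothing is said of
    [fun t => w t x] at a fixed [x], which need not even be measurable. *)
Definition L1_derivative w w' :=
  [/\ forall t : R, 0 <= t -> L1 (w t), forall t : R, 0 <= t -> L1 (w' t) &
      forall t : R, 0 <= t ->
        \int[mu]_(x in D) `|(s - t)^-1 * (w s x - w t x) - w' t x|
          @[s --> punctured_half_line t] --> 0].

Lemma near_punctured_half_line (t : R) :
  \forall s \near punctured_half_line t, 0 <= s /\ s != t.
Proof. by rewrite near_withinE; apply: nearW. Qed.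

Lemma L1_quotient w w' s t : L1_derivative w w' -> 0 <= s -> 0 <= t ->
  L1 (fun x => (s - t)^-1 * (w s x - w t x) - w' t x).
Proof.
move=> [Iw Iw' _] s0 t0; apply: L1B => //; last exact: Iw'.
by apply: L1Z => //; apply: L1B => //; exact: Iw.
Qed.

Lemma L1_derivativeN w w' : L1_derivative w w' ->
  L1_derivative (fun t x => - w t x) (fun t x => - w' t x).
Proof.
move=> [Iw Iw' dw]; split=> [t t0|t t0|t t0].
- by apply: L1N => //; exact: Iw.
- by apply: L1N => //; exact: Iw'.
- have := dw t t0; apply: cvg_trans; apply: near_eq_cvg; apply: nearW => s.
  by apply: eq_Rintegral => x _; rewrite -normrN; congr (`|_|); ring.
Qed.

Lemma L1_derivativeB w1 w1' w2 w2' :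
  L1_derivative w1 w1' -> L1_derivative w2 w2' ->
  L1_derivative (fun t x => w1 t x - w2 t x) (fun t x => w1' t x - w2' t x).
Proof.
move=> dw1 dw2; have [Iw1 Iw1' cw1] := dw1; have [Iw2 Iw2' cw2] := dw2.
split=> [t t0|t t0|t t0]; [by apply: L1B; auto|by apply: L1B; auto|].
have /(_ _) cs := cvgD (cw1 t t0) (cw2 t t0).
rewrite addr0 in cs.
apply: (squeeze_cvgr _ (cvg_cst (0 : R)) cs).
near=> s; have [s0 _] : 0 <= s /\ s != t.
  by near: s; exact: near_punctured_half_line.
have I1 := L1_quotient dw1 s0 t0; have I2 := L1_quotient dw2 s0 t0.
rewrite Rintegral_ge0 //= fctE -RintegralD //; [|exact: L1_norm..].
apply: le_Rintegral => //.
- apply/L1_norm; rewrite (_ : (fun x => _ : R) = (fun x =>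
    ((s - t)^-1 * (w1 s x - w1 t x) - w1' t x) -
    ((s - t)^-1 * (w2 s x - w2 t x) - w2' t x))); last first.
    by apply/funext => x; ring.
  exact: L1B.
- by apply: L1D => //; exact: L1_norm.
- move=> x _; apply: le_trans (ler_normB _ _).
  rewrite le_eqVlt; apply/orP; left.
  by apply/eqP; congr (`|_|); ring.
Unshelve. all: by end_near. Qed.

Lemma L1_derivative_Rintegral w w' (A : set T) t : L1_derivative w w' ->
  measurable A -> A `<=` D -> 0 <= t ->
  half_line_derivative (fun s => \int[mu]_(x in A) w s x) t
                       (\int[mu]_(x in A) w' t x).
Proof.
move=> dw mA AD t0; have [Iw Iw' cw] := dw.
have IA f : L1 f -> mu.-integrable A (EFin \o f) by exact: integrableS.
apply/cvgrPdist_lt => e e0.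
have /cvgrPdist_lt/(_ e e0) := cw t t0; apply: filter_app; near=> s.
have [s0 _] : 0 <= s /\ s != t by near: s; exact: near_punctured_half_line.
rewrite sub0r normrN; apply: le_lt_trans.
have -> : \int[mu]_(x in A) w' t x - (s - t)^-1 *
    (\int[mu]_(x in A) w s x - \int[mu]_(x in A) w t x) =
    - \int[mu]_(x in A) ((s - t)^-1 * (w s x - w t x) - w' t x).
  rewrite RintegralB //; [|by apply: L1Z => //; apply: L1B => //; exact/IA/Iw|
    exact/IA/Iw'].
  rewrite RintegralZl //; last by apply: L1B => //; exact/IA/Iw.
  by rewrite RintegralB //; [ring|exact/IA/Iw..].
have IQ := L1_quotient dw s0 t0.
rewrite normrN (le_trans (le_normr_Rintegral mA (IA _ IQ))) //.
rewrite ger0_norm ?Rintegral_ge0 //.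
by apply: Rintegral_subset => //; exact: L1_norm.
Unshelve. all: by end_near. Qed.

(** The L^1 norm is continuous along the curve, hence bounded on a segment. *)
Lemma L1_derivative_bounded w w' (H : R) : L1_derivative w w' -> 0 <= H ->
  exists B, forall s, 0 <= s <= H -> \int[mu]_(x in D) `|w s x| <= B.
Proof.
move=> dw H0; have [Iw Iw' cw] := dw.
pose phi s := \int[mu]_(x in D) `|w s x|.
suff cphi : {within `[0, H], continuous phi}.
  have [c _ cmax] := EVT_max H0 cphi; exists (phi c) => s sH.
  by apply: cmax; rewrite in_itv.
apply/subspace_continuousP => t; rewrite /= in_itv /= => /andP[t0 tH].
apply/cvgrPdist_lt => e e0; rewrite near_withinE.
have := cw t t0 => /cvgrPdist_lt/(_ 1 ltr01).
rewrite near_withinE => dq.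
pose b := 1 + \int[mu]_(x in D) `|w' t x|.
have b0 : 0 < b by rewrite ltr_wpDr // Rintegral_ge0.
near=> s; rewrite /= in_itv /= => /andP[s0 _].
have [->|st] := eqVneq s t; first by rewrite subrr normr0.
have : `|0 - \int[mu]_(x in D) `|(s - t)^-1 * (w s x - w t x) - w' t x| | < 1.
  by apply: (near dq s).
rewrite sub0r normrN ger0_norm ?Rintegral_ge0 // => q1.
have st' : `|s - t| < e / b.
  rewrite distrC; near: s; apply/nbhs_ballP.
  by exists (e / b) => //=; rewrite divr_gt0.
have IQ := L1_quotient dw s0 t0.
have Is : L1 (w s) by exact: Iw.
have It : L1 (w t) by exact: Iw.
have It' : L1 (w' t) by exact: Iw'.
rewrite /phi -RintegralB; [|by []|exact: L1_norm..].
apply: (@le_lt_trans _ _ (\int[mu]_(x in D) (`|s - t| *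
  (`|(s - t)^-1 * (w s x - w t x) - w' t x| + `|w' t x|)))).
  apply: le_trans (le_normr_Rintegral mD _) _.
    by apply: L1B => //; exact: L1_norm.
  apply: le_Rintegral => //.
  - by apply/L1_norm/L1B => //; exact: L1_norm.
  - by apply: L1Z => //; apply: L1D => //; exact: L1_norm.
  - move=> x _; apply: le_trans (ler_dist_dist _ _) _.
    apply: (@le_trans _ _ (`|s - t| * `|(s - t)^-1 * (w s x - w t x)|)).
      by rewrite -normrM mulrA divff ?mul1r ?subr_eq0 // distrC.
    rewrite ler_wpM2l //; apply: le_trans (ler_normD _ _).
    by rewrite subrK.
rewrite RintegralZl //; last by apply: L1D => //; exact: L1_norm.
rewrite RintegralD //; [|exact: L1_norm..].
apply: (@le_lt_trans _ _ (`|s - t| * b)).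
  by rewrite ler_wpM2l // lerD2r ltW.
by rewrite -ltr_pdivlMr.
Unshelve. all: by end_near. Qed.

(** Integrated over an arbitrary measurable set, the differential inequality
    becomes a scalar one. The conclusion follows for the integrals over all
    sets, hence almost everywhere, without choosing representatives that are
    differentiable in time at almost every point. *)
Lemma L1_linear_decay w w' (a b c : R) : L1_derivative w w' ->
  0 <= a -> a <= b ->
  (forall s, a <= s <= b ->
    {ae mu, forall x, D x -> w' s x <= - w s x + c}) ->
  {ae mu, forall x, D x ->
    expR (b - a) * w b x <= w a x + (expR (b - a) - 1) * c}.
Proof.
move=> dw a0 ab wc; have [Iw Iw' _] := dw.
have b0 := le_trans a0 ab.
pose E := expR (b - a).
suff : {ae mu, forall x, D x -> E * w b x - (w a x + (E - 1) * c) <= 0}.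
  by apply: filterS => x + Dx => /(_ Dx); rewrite subr_le0.
have IEb : L1 (fun x => E * w b x) by apply: L1Z => //; exact: Iw.
have Iac : L1 (fun x => w a x + (E - 1) * c).
  by apply: L1D => //; [exact: Iw|exact: L1_cst].
apply: ae_le0_Rintegral => //; first exact: L1B.
move=> A mA AD.
have IA f : L1 f -> mu.-integrable A (EFin \o f) by exact: integrableS.
have Ic k : mu.-integrable A (EFin \o cst k) by apply: IA; exact: L1_cst.
rewrite RintegralB //; [|exact: IA..].
rewrite RintegralZl //; last exact/IA/Iw.
rewrite RintegralD //; [|exact/IA/Iw|exact: Ic].
rewrite Rintegral_cst // subr_le0 -mulrA.
apply: (@linear_decay R (fun s => \int[mu]_(x in A) w s x)
  (fun s => \int[mu]_(x in A) w' s x)) => //.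
- move=> t /andP[a_t _].
  by apply: L1_derivative_Rintegral => //; exact: le_trans a_t.
- move=> t tab; have t0 : 0 <= t by case/andP: tab => /(le_trans a0).
  have IN : mu.-integrable A (EFin \o (fun x => - w t x)).
    by apply: L1N => //; exact/IA/Iw.
  rewrite -mulN1r -RintegralZl //; last exact/IA/Iw.
  rewrite -Rintegral_cst // -RintegralD //; last 2 first.
  - by apply: L1Z => //; exact/IA/Iw.
  - exact: Ic.
  apply: ae_le_Rintegral => //; first exact/IA/Iw'.
    apply: L1D => //; last exact: Ic.
    by apply: L1Z => //; exact/IA/Iw.
  apply: filterS (wc t tab) => x + Ax => /(_ (AD x Ax)).
  by rewrite mulN1r.
Qed.

End L1_curves.

(** * Pointwise estimates *)

Section pointwise.
Context {R : realType}.
Implicit Types (f : R -> R) (r L C delta d y m c p q E : R).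

Definition locally_lipschitz f := forall r, exists2 C, 0 <= C &
  forall x y, `|x| <= r -> `|y| <= r -> `|f x - f y| <= C * `|x - y|.

Definition above f L r := f (Num.max r L).
Definition below f L r := f (Num.min r (- L)).

(** Up to an additive constant, [f] is the sum of [above f L], [below f L] and
    its restriction to [[- L, L]] extended by constants. Only the last one is
    known to be globally Lipschitz; the other two are kept as they are, to be
    handled by [above_shift] and [below_shift]. *)
Lemma increment_split f L C delta r : 0 <= L -> 0 <= delta -> 0 <= C ->
  (forall x y, `|x| <= L -> `|y| <= L -> `|f x - f y| <= C * `|x - y|) ->
  f (r + delta) - f r <= C * delta + (above f L (r + delta) - above f L r)
                                   + (below f L (r + delta) - below f L r).
Proof.
move=> L0 delta0 C0 fC.
pose clamp x := Num.max (- L) (Num.min x L).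
have fE x : f x = f (clamp x) + above f L x + below f L x - f L - f (- L).
  rewrite /clamp /above /below.
  have [xL|Lx] := leP x L; have [xL'|Lx'] := leP x (- L).
  - by ring.
  - by ring.
  - by lra.
  - by rewrite max_r; [ring|lra].
have cL x : `|clamp x| <= L.
  rewrite /clamp ler_norml le_max lexx /= ge_max ge_min lexx orbT andbT.
  by lra.
have cdelta : `|clamp (r + delta) - clamp r| <= delta.
  rewrite /clamp.
  have [q_p p_q] : Num.min r L <= Num.min (r + delta) L /\
      Num.min (r + delta) L <= Num.min r L + delta.
    by have [?|?] := leP r L; have [?|?] := leP (r + delta) L; split; lra.
  move: (Num.min _ _) (Num.min _ _) q_p p_q => q p q_p p_q; rewrite ler_norml.
  by have [?|?] := leP (- L) p; have [?|?] := leP (- L) q; lra.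
have := fC _ _ (cL (r + delta)) (cL r).
have := ler_wpM2l C0 cdelta.
have := ler_norm (f (clamp (r + delta)) - f (clamp r)).
by rewrite (fE (r + delta)) (fE r); lra.
Qed.

Lemma above_le f L c1 c2 r : 0 <= L -> 0 <= c1 -> 0 <= c2 ->
  (forall x, `|f x| <= c1 * `|x| + c2) ->
  above f L r <= f L + (2 * c1 * `|r| + 2 * c2).
Proof.
move=> L0 c10 c20 fc; rewrite /above; have := normr_ge0 r.
have [rL|Lr] := leP r L; first by nra.
have := fc r; have := fc L; have := ler_norm r; rewrite (ger0_norm L0).
have := ler_norm (f r); have := ler_norm (- f L); rewrite normrN.
by nra.
Qed.

Lemma le_above f L r : {homo f : x y / x <= y} -> f L <= above f L r.
Proof. by move=> fmono; apply: fmono; rewrite le_max lexx orbT. Qed.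

Lemma below_ge f L c1 c2 r : 0 <= L -> 0 <= c1 -> 0 <= c2 ->
  (forall x, `|f x| <= c1 * `|x| + c2) ->
  f (- L) - (2 * c1 * `|r| + 2 * c2) <= below f L r.
Proof.
move=> L0 c10 c20 fc; rewrite /below; have := normr_ge0 r.
have [rL|Lr] := leP r (- L); last by nra.
have := fc r; have := fc (- L); have := ler_norm (- r).
rewrite !normrN (ger0_norm L0).
have := ler_norm (f (- L)); have := ler_norm (- f r); rewrite normrN.
by nra.
Qed.

Lemma below_le f L r : {homo f : x y / x <= y} -> below f L r <= f (- L).
Proof. by move=> fmono; apply: fmono; rewrite ge_min lexx orbT. Qed.

(** Think of [p] as an earlier and of [q] as a later value of a trajectory, at
    times that differ by [d]. If [q] is above [L - delta], then the trajectory
    has come down by at least [d * (L - delta - c)] in between, so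
    [q + delta <= p]; otherwise [above f L] takes its least value at
    [q + delta]. *)
Lemma above_shift f L delta d c p q : {homo f : x y / x <= y} ->
  0 <= d -> c + delta <= L -> delta <= d * (L - delta - c) ->
  expR d * q <= p + (expR d - 1) * c ->
  above f L (q + delta) <= above f L p.
Proof.
move=> fmono d0 cL dL pq; apply: fmono.
have [qL|Lq] := leP (q + delta) L; first by rewrite le_max lexx orbT.
rewrite le_max; apply/orP; left.
by have := expR_ge1Dx d; nra.
Qed.

(** Here [q] is the earlier value: far below zero the trajectory goes up. *)
Lemma below_shift f L delta d c p q : {homo f : x y / x <= y} ->
  0 <= d -> c <= L -> delta <= d * (L - c) ->
  - (expR d * p) <= - q + (expR d - 1) * c ->
  below f L (q + delta) <= below f L p.
Proof.
move=> fmono d0 cL dL pq; apply: fmono.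
have [Lp|pL] := leP (- L) p; first by rewrite ge_min lexx orbT.
rewrite ge_min; apply/orP; left.
by have := expR_ge1Dx d; nra.
Qed.

Lemma decay_le_linear d y m c : 0 <= d -> 0 <= m -> 0 <= c ->
  expR d * y <= m + (expR d - 1) * c -> y <= m + d * c.
Proof.
move=> d0 m0 c0 ym.
have := ler_wpM2l (expR_ge0 (- d)) ym.
have ee : expR (- d) * expR d = 1 by rewrite -expRD addNr expR0.
rewrite mulrA ee mul1r mulrDr mulrA mulrBr ee mulr1 => yme.
have := expR_ge1Dx (- d).
have : expR (- d) <= 1 by rewrite -(expR0 R) ler_expR oppr_le0.
by nra.
Qed.

End pointwise.

(** * Comparison with a curve that moves fast where it is large *)

Section comparison.
Context d (T : measurableType d) (R : realType).
Variables (mu : {measure set T -> \bar R}) (D : set T).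
Hypotheses (mD : measurable D) (Dfin : (mu D < +oo)%E).
Local Notation L1 f := (mu.-integrable D (EFin \o f)).
Local Notation integral f := (\int[mu]_(x in D) f x).

Variables (f : R -> R) (c1 c2 : R).
Hypotheses (c1_ge0 : 0 <= c1) (c2_ge0 : 0 <= c2).
Hypothesis f_mono : {homo f : x y / x <= y}.
Hypothesis f_growth : forall x, `|f x| <= c1 * `|x| + c2.
Hypothesis f_lip : locally_lipschitz f.

(** [u] is a solution and [w] the excess of a subsolution over [u]. The equation
    enters only through [u'_bound], [w'_bound] and [w'_increment]. *)
Variables (u u' w w' : R -> T -> R).
Hypotheses (du : L1_derivative mu D u u') (dw : L1_derivative mu D w w').
Variables (H B c K0 K : R).
Hypotheses (c_ge0 : 0 <= c) (K0_gt0 : 0 < K0) (K_ge0 : 0 <= K).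
Hypothesis u_bounded : forall s, 0 <= s <= H ->
  integral (fun x => `|u s x|) <= B.
Hypothesis u'_bound : forall s, 0 <= s <= H ->
  {ae mu, forall x, D x -> `|u' s x + u s x| <= c}.
Hypothesis w'_bound : forall s, 0 <= s <= H ->
  {ae mu, forall x, D x -> w' s x <= - w s x + K0}.
Hypothesis w'_increment : forall s delta, 0 <= s <= H -> 0 <= delta ->
  {ae mu, forall x, D x -> w s x <= delta} ->
  {ae mu, forall x, D x -> w' s x <=
    - w s x + K * integral (fun y => f (u s y + delta) - f (u s y))}.

Lemma u_increase_bound r s : 0 <= r -> r <= s -> s <= H ->
  {ae mu, forall x, D x ->
    expR (s - r) * u s x <= u r x + (expR (s - r) - 1) * c}.
Proof.
move=> r0 rs sH; apply: (L1_linear_decay mD Dfin du) => // t /andP[rt ts].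
have tH : 0 <= t <= H by rewrite (le_trans r0) ?(le_trans ts).
apply: filterS (u'_bound tH) => x + Dx => /(_ Dx).
by rewrite ler_norml => /andP[]; lra.
Qed.

Lemma u_decrease_bound r s : 0 <= r -> r <= s -> s <= H ->
  {ae mu, forall x, D x ->
    - (expR (s - r) * u s x) <= - u r x + (expR (s - r) - 1) * c}.
Proof.
move=> r0 rs sH; have := L1_linear_decay mD Dfin (L1_derivativeN mD du) r0 rs.
move=> /(_ c) dN; apply: filterS (dN _).
  by move=> x + Dx => /(_ Dx); rewrite mulrN.
move=> t /andP[rt ts].
have tH : 0 <= t <= H by rewrite (le_trans r0) ?(le_trans ts).
apply: filterS (u'_bound tH) => x + Dx => /(_ Dx).
by rewrite ler_norml => /andP[]; lra.
Qed.

Let m := fine (mu D).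

Let m_ge0 : 0 <= m. Proof. exact/fine_ge0/measure_ge0. Qed.

(** By [above_le] and [below_ge] this bounds how far the integrals of
    [above f L \o u t] and [below f L \o u t] are from [f L * m] and
    [f (- L) * m]. *)
Let G := 2 * c1 * (B + (c + K0) * m) + 2 * c2 * m.

(** The first term makes the speed of [u] exceed [L / 2] outside of [[- L, L]],
    the second one makes the contribution of [above f L] and [below f L] in
    [halved_bound] at most [delta / 4]. *)
Let L := 2 * (K0 + c) + 32 * K * `|G| + 1.

Let L_big : 2 * (K0 + c) + 1 <= L.
Proof.
have Kg : 0 <= K * `|G| by rewrite mulr_ge0.
by rewrite /L -mulrA; lra.
Qed.

Let L_ge0 : 0 <= L.
Proof. by have := L_big; have := c_ge0; have := K0_gt0; lra. Qed.

Let L1_u s : 0 <= s -> L1 (u s). Proof. by case: du => + _ _; apply. Qed.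

Let L1_comp (g : R -> R) v : {homo g : x y / x <= y} ->
  (exists a b, forall x, `|g x| <= a * `|x| + b) -> L1 v -> L1 (g \o v).
Proof.
move=> gmono [a [b gab]] Iv.
apply: (L1_comp_linear_growth mD Dfin _ gab Iv).
exact: nondecreasing_measurable.
Qed.

Let L1_f v : L1 v -> L1 (f \o v).
Proof. by apply: L1_comp => //; exists c1, c2. Qed.

Let above_mono : {homo above f L : x y / x <= y}.
Proof.
by move=> x y xy; apply: f_mono; rewrite ge_max !le_max xy lexx orbT.
Qed.

Let below_mono : {homo below f L : x y / x <= y}.
Proof.
by move=> x y xy; apply: f_mono; rewrite le_min !ge_min xy lexx orbT.
Qed.

Let L1_above v : L1 v -> L1 (above f L \o v).
Proof.
apply: L1_comp => //; exists c1, (c1 * L + c2) => x.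
apply: le_trans (f_growth _) _; rewrite addrA lerD2r -mulrDr ler_wpM2l //.
rewrite ler_norml; have := ler_norm x; have := ler_norm (- x); rewrite normrN.
by have := L_ge0; have [?|?] := leP x L; lra.
Qed.

Let L1_below v : L1 v -> L1 (below f L \o v).
Proof.
apply: L1_comp => //; exists c1, (c1 * L + c2) => x.
apply: le_trans (f_growth _) _; rewrite addrA lerD2r -mulrDr ler_wpM2l //.
rewrite ler_norml; have := ler_norm x; have := ler_norm (- x); rewrite normrN.
by have := L_ge0; have [?|?] := leP x (- L); lra.
Qed.

Let L1_shift v (delta : R) : L1 v -> L1 (fun x => v x + delta).
Proof. by move=> Iv; apply: L1D => //; exact: L1_cst. Qed.

Section interval.
Variables (a Tm delta Cl : R).
Hypotheses (a_ge0 : 0 <= a) (Tm_ge0 : 0 <= Tm) (aTH : a + Tm + 2 <= H).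
Hypotheses (delta_gt0 : 0 < delta) (deltaK0 : delta <= K0).
Hypothesis Cl_ge0 : 0 <= Cl.
Hypothesis f_Cl : forall x y, `|x| <= L -> `|y| <= L ->
  `|f x - f y| <= Cl * `|x - y|.
Hypothesis w_delta : forall t, a <= t <= a + Tm ->
  {ae mu, forall x, D x -> w t x <= delta}.
Hypothesis w_a : {ae mu, forall x, D x -> w a x <= 0}.

(** The time needed to move by [delta] at the speed [L / 2]. *)
Let tau := 2 * delta / L.

Let L_gt0 : 0 < L.
Proof. by have := L_big; have := c_ge0; have := K0_gt0; lra. Qed.

Let tauL : tau * L = 2 * delta.
Proof. by rewrite /tau divfK // gt_eqF. Qed.

Let tau_gt0 : 0 < tau. Proof. by rewrite divr_gt0 // mulr_gt0. Qed.

Let tau_le1 : tau <= 1.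
Proof.
rewrite /tau ler_pdivrMr // mul1r.
by have := L_big; have := c_ge0; have := deltaK0; lra.
Qed.

Let tau_delta : delta <= tau * (L - delta - c).
Proof.
have := ler_wpM2l (ltW tau_gt0) L_big; have := ler_wpM2l (ltW tau_gt0) deltaK0.
by have := mulr_ge0 (ltW tau_gt0) c_ge0; have := tauL; have := tau_gt0; lra.
Qed.

Let speed_gt0 : 0 <= L - delta - c /\ delta > 0.
Proof.
have := L_big; have := c_ge0; have := deltaK0; have := delta_gt0.
by split; lra.
Qed.

Let above_later r s : 0 <= r -> r <= s -> s <= H ->
  {ae mu, forall x, D x -> above f L (u s x) <= above f L (u r x)}.
Proof.
move=> r0 rs sH.
apply: filterS (u_increase_bound r0 rs sH) => x + Dx => /(_ Dx).
rewrite -[u s x in X in _ -> X]addr0.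
have [] := speed_gt0 => ? ?.
apply: above_shift => //; [lra|lra|].
by rewrite mulr_ge0 ?subr_ge0//; lra.
Qed.

Let above_later_delta r s : 0 <= r -> r + tau <= s -> s <= H ->
  {ae mu, forall x, D x -> above f L (u s x + delta) <= above f L (u r x)}.
Proof.
move=> r0 rs sH; have rs' : r <= s by have := tau_gt0; lra.
have [] := speed_gt0 => ? ?.
apply: filterS (u_increase_bound r0 rs' sH) => x + Dx => /(_ Dx).
apply: above_shift => //; [lra|lra|].
by apply: le_trans tau_delta _; rewrite ler_wpM2r //; lra.
Qed.

Let below_later r s : 0 <= r -> r <= s -> s <= H ->
  {ae mu, forall x, D x -> below f L (u r x) <= below f L (u s x)}.
Proof.
move=> r0 rs sH.
apply: filterS (u_decrease_bound r0 rs sH) => x + Dx => /(_ Dx).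
rewrite -[X in below f L X <= _]addr0.
have [] := speed_gt0 => ? ?.
apply: below_shift => //; [lra|lra|].
by rewrite mulr_ge0 ?subr_ge0//; lra.
Qed.

Let below_later_delta r s : 0 <= r -> r + tau <= s -> s <= H ->
  {ae mu, forall x, D x -> below f L (u r x + delta) <= below f L (u s x)}.
Proof.
move=> r0 rs sH; have rs' : r <= s by have := tau_gt0; lra.
have [] := speed_gt0 => ? ?.
apply: filterS (u_decrease_bound r0 rs' sH) => x + Dx => /(_ Dx).
apply: below_shift => //; [lra|lra|].
have : tau * (L - c) <= (s - r) * (L - c) by rewrite ler_wpM2r //; lra.
by have := tau_delta; have := mulr_gt0 tau_gt0 delta_gt0; lra.
Qed.

(** The time grid is [a + k * tau]. The indices of [Y] are shifted by one: [Y 0]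
    stands for the time [a - tau], at which [u] may not be defined and is
    replaced by an upper bound of [u s + delta] for all [s] from [a] to [H]. *)
Let start x := `|u a x| + (c + K0).
Let Y k := integral
  (above f L \o (if k is j.+1 then u (a + j%:R * tau) else start)).
Let X k := integral (below f L \o u (a + k%:R * tau)).

Let L1_start : L1 start.
Proof. by apply: L1D => //; [apply/L1_norm/L1_u|exact: L1_cst]. Qed.

Let grid_ge0 k : 0 <= a + k%:R * tau.
Proof. by rewrite addr_ge0 // mulr_ge0 // ltW. Qed.

Let start_above s : a <= s -> s <= H ->
  {ae mu, forall x, D x -> above f L (u s x + delta) <= above f L (start x)}.
Proof.
move=> as_ sH; apply: filterS (u_increase_bound a_ge0 as_ sH) => x + Dx.
move=> /(_ Dx) ux; apply: above_mono; rewrite /start.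
suff : u s x <= `|u a x| + c by have := deltaK0; lra.
have := expR_ge1Dx (s - a); have := ler_norm (u a x).
rewrite leNgt => ? ?; apply/negP => ?.
by have := normr_ge0 (u a x); have := c_ge0; nra.
Qed.

Let above_step k s : a + k%:R * tau <= s -> s <= a + k.+1%:R * tau ->
  a + k.+1%:R * tau <= H ->
  integral (fun x => above f L (u s x + delta)) <= Y k /\
  Y k.+2 <= integral (fun x => above f L (u s x)).
Proof.
move=> ks sk kH; have s0 := le_trans (grid_ge0 k) ks.
have sH := le_trans sk kH.
have Is := L1_above (L1_u s0).
have Isd := L1_above (L1_shift delta (L1_u s0)).
split; last first.
  apply: ae_le_Rintegral => //; first exact/L1_above/L1_u/grid_ge0.
  exact: above_later.
apply: ae_le_Rintegral => //.
  by apply: L1_above; case: (k) => // j; exact/L1_u/grid_ge0.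
case: k ks sk kH => [|j] ks sk kH /=.
  by apply: start_above => //; move: ks; rewrite mul0r addr0.
apply: above_later_delta => //.
by move: ks; rewrite -natr1 mulrDl mul1r addrA.
Qed.

Let below_step k s : a + k%:R * tau <= s -> s <= a + k.+1%:R * tau ->
  a + k.+2%:R * tau <= H ->
  integral (fun x => below f L (u s x + delta)) <= X k.+2 /\
  X k <= integral (fun x => below f L (u s x)).
Proof.
move=> ks sk kH; have s0 := le_trans (grid_ge0 k) ks.
have sk2 : s + tau <= a + k.+2%:R * tau.
  by rewrite -natr1 mulrDl mul1r addrA lerD2r.
have sH : s <= H.
  by apply: le_trans kH; apply: le_trans sk2; have := tau_gt0; lra.
have Is := L1_below (L1_u s0).
have Isd := L1_below (L1_shift delta (L1_u s0)).
split.
  apply: ae_le_Rintegral => //; first exact/L1_below/L1_u/grid_ge0.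
  exact: below_later_delta.
apply: ae_le_Rintegral => //; first exact/L1_below/L1_u/grid_ge0.
by apply: below_later => //; exact: grid_ge0.
Qed.

(** The monotonicity in time of [above f L \o u] and [below f L \o u] replaces
    the integrals at time [s] by those at the neighbouring times of the grid,
    and a lead of [delta] in space by a lead of [tau] in time. What is left are
    differences that telescope when summed over [k]. *)
Let increment_step k s : a + k%:R * tau <= s -> s <= a + k.+1%:R * tau ->
  a + k.+2%:R * tau <= H ->
  [/\ integral (fun y => f (u s y + delta) - f (u s y)) <=
       Cl * delta * m + (Y k - Y k.+2) + (X k.+2 - X k),
     0 <= Y k - Y k.+2 & 0 <= X k.+2 - X k].
Proof.
move=> ks sk kH; have s0 := le_trans (grid_ge0 k) ks.
have kH1 : a + k.+1%:R * tau <= H.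
  apply: le_trans kH; rewrite -[k.+2%:R]natr1 mulrDl mul1r addrA.
  by have := tau_gt0; lra.
have [Y1 Y2] := above_step ks sk kH1; have [X1 X2] := below_step ks sk kH.
have Ius := L1_u s0; have Isd := L1_shift delta Ius.
have A1 := L1_above Ius; have A2 := L1_above Isd.
have B1 := L1_below Ius; have B2 := L1_below Isd.
have A12 : integral (fun x => above f L (u s x)) <=
    integral (fun x => above f L (u s x + delta)).
  by apply: le_Rintegral => // x _; apply: above_mono; have := delta_gt0; lra.
have B12 : integral (fun x => below f L (u s x)) <=
    integral (fun x => below f L (u s x + delta)).
  by apply: le_Rintegral => // x _; apply: below_mono; have := delta_gt0; lra.
split; [|lra|lra].
apply: (@le_trans _ _ (integral (fun x => Cl * delta +
    (above f L (u s x + delta) - above f L (u s x)) +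
    (below f L (u s x + delta) - below f L (u s x))))).
  apply: le_Rintegral => //.
  - by apply: L1B => //; exact: L1_f.
  - apply: L1D => //; last exact: L1B.
    by apply: L1D => //; [exact: L1_cst|exact: L1B].
  - by move=> x _; apply: increment_split => //; exact: ltW.
have I1 : L1 (fun=> Cl * delta) by exact: L1_cst.
rewrite RintegralD //; [|by apply: L1D => //; exact: L1B|exact: L1B].
rewrite [X in _ + X <= _]RintegralB // RintegralD //; [|exact: L1B].
by rewrite RintegralB // Rintegral_cst // -/m; lra.
Qed.

(** The telescoped sum over the first [k] intervals of the differences in
    [increment_step]. *)
Let S k := (Y 0 + Y 1 - Y k - Y k.+1) + (X k + X k.+1 - X 0 - X 1).

Let telescoping_step k t : a + k%:R * tau <= t -> t <= a + k.+1%:R * tau ->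
  t <= a + Tm -> 0 <= S k ->
  {ae mu, forall x, D x -> w (a + k%:R * tau) x <=
    K * (k%:R * tau * (Cl * delta * m) + tau * S k)} ->
  0 <= S k.+1 /\
  {ae mu, forall x, D x -> w t x <=
    K * ((t - a) * (Cl * delta * m) + tau * S k.+1)}.
Proof.
move=> kt tk tT Sk wk.
have kH : a + k.+2%:R * tau <= H.
  rewrite -[k.+2%:R]natr1 -[k.+1%:R]natr1 !mulrDl mul1r.
  by have := aTH; have := tau_le1; lra.
pose hl := (Y k - Y k.+2) + (X k.+2 - X k).
have SE : S k.+1 = S k + hl by rewrite /S /hl; ring.
have [_ Yk Xk] := increment_step kt tk kH.
have hl0 : 0 <= hl by rewrite addr_ge0.
split; first by rewrite SE addr_ge0.
pose q := Cl * delta * m.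
have q0 : 0 <= q.
  by apply: mulr_ge0 => //; apply: mulr_ge0 => //; exact: ltW.
have := L1_linear_decay mD Dfin dw (grid_ge0 k) kt.
move=> /(_ (K * (q + hl)) _)/filterS2; apply; last exact: wk; last first.
  move=> s /andP[ks st].
  have sH : 0 <= s <= H.
    rewrite (le_trans (grid_ge0 k)) //= (le_trans _ kH) //.
    rewrite -[k.+2%:R]natr1 mulrDl mul1r addrA.
    by have := tau_gt0; lra.
  have sT : a <= s <= a + Tm.
    rewrite (le_trans st) // andbT (le_trans _ ks) // lerDl mulr_ge0 //.
    exact: ltW.
  have := w'_increment sH (ltW delta_gt0) (w_delta sT).
  apply: filterS => x + Dx => /(_ Dx) /le_trans; apply.
  rewrite lerD2l ler_wpM2l //.
  have [inc _ _] := increment_step ks (le_trans st tk) kH.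
  by apply: le_trans inc _; rewrite /q /hl [leRHS]addrA.
move=> x wx wkx Dx.
pose m0 := K * (k%:R * tau * q + tau * S k).
have m00 : 0 <= m0.
  have tau0 := ltW tau_gt0.
  have ktau0 : 0 <= k%:R * tau by exact: mulr_ge0.
  by apply: mulr_ge0 => //; apply: addr_ge0; exact: mulr_ge0.
apply: (@le_trans _ _ (m0 + (t - (a + k%:R * tau)) * (K * (q + hl)))).
  apply: decay_le_linear => //; first by rewrite subr_ge0.
    by rewrite mulr_ge0 // addr_ge0.
  by apply: le_trans (wx Dx) _; rewrite lerD2r; exact: wkx.
rewrite /m0 [_ * (K * _)]mulrCA -mulrDr ler_wpM2l // SE.
have : (t - (a + k%:R * tau)) * hl <= tau * hl.
  by rewrite ler_wpM2r //; move: tk; rewrite -natr1 mulrDl mul1r; lra.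
by rewrite -/q; lra.
Qed.

Let telescoping_bound k : a + k%:R * tau <= a + Tm ->
  0 <= S k /\
  {ae mu, forall x, D x -> w (a + k%:R * tau) x <=
    K * (k%:R * tau * (Cl * delta * m) + tau * S k)}.
Proof.
elim: k => [_|k IH kT].
  have S0 : S 0 = 0 by rewrite /S; ring.
  split; first by rewrite S0.
  rewrite mul0r addr0; apply: filterS w_a => x + Dx => /(_ Dx) /le_trans; apply.
  by rewrite S0 mul0r mulr0 addr0 mulr0.
have kk : a + k%:R * tau <= a + k.+1%:R * tau.
  by rewrite lerD2l ler_pM2r // ler_nat.
have [Sk wk] := IH (le_trans kk kT).
have := telescoping_step kk (lexx _) kT Sk wk.
by rewrite [a + _ - a]addrAC subrr add0r.
Qed.

Let Y_ge k : f L * m <= Y k.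
Proof.
rewrite -Rintegral_cst //; apply: le_Rintegral => //; first exact: L1_cst.
  by apply: L1_above; case: k => // k; exact/L1_u/grid_ge0.
by move=> x _; exact: le_above.
Qed.

Let X_le k : X k <= f (- L) * m.
Proof.
rewrite -Rintegral_cst //; apply: le_Rintegral => //; last 2 first.
- exact: L1_cst.
- by move=> x _; exact: below_le.
- exact/L1_below/L1_u/grid_ge0.
Qed.

Let growth_le v b : L1 v -> integral (fun x => `|v x|) <= b ->
  b <= B + (c + K0) * m ->
  integral (fun x => 2 * c1 * `|v x| + 2 * c2) <= G.
Proof.
move=> Iv vb bB; rewrite Rintegral_affine // /G lerD2r ler_wpM2l //.
  by rewrite mulr_ge0.
exact: le_trans bB.
Qed.

Let cK0m_ge0 : 0 <= (c + K0) * m.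
Proof. by rewrite mulr_ge0 // addr_ge0 // ltW. Qed.

Let a_le_H : 0 <= a <= H.
Proof. by rewrite a_ge0 /=; have := aTH; have := Tm_ge0; lra. Qed.

Let Y_le v : L1 v -> integral (fun x => `|v x|) <= B + (c + K0) * m ->
  integral (above f L \o v) <= f L * m + G.
Proof.
move=> Iv vB; have := growth_le Iv vB (lexx _).
rewrite -(lerD2l (f L * m)); apply: le_trans.
have Ia := L1_affine mD Dfin (2 * c1) (2 * c2) Iv.
rewrite -Rintegral_cst // -RintegralD //; last exact: L1_cst.
apply: le_Rintegral => //; first exact: L1_above.
  by apply: L1D => //; exact: L1_cst.
by move=> x _ /=; exact: above_le.
Qed.

Let X_ge k : a + k%:R * tau <= H -> f (- L) * m - G <= X k.
Proof.
move=> kH; have Iv := L1_u (grid_ge0 k).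
have /(growth_le Iv) : integral (fun x => `|u (a + k%:R * tau) x|) <= B.
  by apply: u_bounded; rewrite grid_ge0.
rewrite lerDl => /(_ cK0m_ge0) ?.
apply: (@le_trans _ _ (f (- L) * m -
  integral (fun x => 2 * c1 * `|u (a + k%:R * tau) x| + 2 * c2))).
  by rewrite lerD2l lerN2.
have Ia := L1_affine mD Dfin (2 * c1) (2 * c2) Iv.
rewrite -Rintegral_cst // -RintegralB //; last exact: L1_cst.
apply: le_Rintegral => //; [|exact: L1_below|].
  by apply: L1B => //; exact: L1_cst.
by move=> x _ /=; exact: below_ge.
Qed.

Let S_le k : S k <= 4 * `|G|.
Proof.
have YL := Y_ge k; have YL1 := Y_ge k.+1.
have XL := X_le k; have XL1 := X_le k.+1.
have Bu : integral (fun x => `|u a x|) <= B by exact: u_bounded.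
have Iua : L1 (u a) by exact: L1_u.
have Y0 : Y 0 <= f L * m + G.
  apply: Y_le => //; rewrite (_ : Rintegral _ _ _ =
      integral (fun x => 1 * `|u a x| + (c + K0))).
    by rewrite Rintegral_affine // mul1r lerD2r.
  apply: eq_Rintegral => x _; rewrite /start mul1r ger0_norm // addr_ge0 //.
  by rewrite addr_ge0 // ltW.
have Y1 : Y 1 <= f L * m + G.
  apply: Y_le; first exact: L1_u.
  by rewrite mul0r addr0 (le_trans Bu) // lerDl.
have X0 : f (- L) * m - G <= X 0.
  by apply: X_ge; rewrite mul0r addr0; case/andP: a_le_H.
have X1 : f (- L) * m - G <= X 1.
  apply: X_ge; rewrite mul1r.
  by have := aTH; have := Tm_ge0; have := tau_le1; lra.
have := ler_norm G.
by rewrite /S; lra.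
Qed.

(** The part of [f] between [- L] and [L] contributes at most
    [K * Cl * m * Tm] times [delta], which is small for short times. The
    remainder contributes at most [4 * K * tau * `|G|]: it is proportional to
    [delta] as [tau] is, and small because [L] is large. *)
Lemma halved_bound : 4 * (K * Cl * m) * Tm <= 1 ->
  forall t, a <= t <= a + Tm -> {ae mu, forall x, D x -> w t x <= delta / 2}.
Proof.
move=> Tm_small t /andP[a_t tT].
have t0 : 0 <= (t - a) / tau by rewrite divr_ge0 ?subr_ge0 // ltW.
have /andP[] := truncn_itv t0.
set k := Num.truncn _; rewrite ler_pdivlMr // ltr_pdivrMr // => kt tk.
have kt' : a + k%:R * tau <= t by lra.
have [Sk wk] := telescoping_bound (le_trans kt' tT).
have tk' : t <= a + k.+1%:R * tau by lra.
have [_ +] := telescoping_step kt' tk' tT Sk wk.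
apply: filterS => x + Dx => /(_ Dx) /le_trans; apply.
have h1 : K * ((t - a) * (Cl * delta * m)) <= delta / 4.
  have -> : K * ((t - a) * (Cl * delta * m)) =
    (4 * (K * Cl * m) * (t - a)) * (delta / 4) by field.
  rewrite -[leRHS]mul1r ler_wpM2r //; first by rewrite divr_ge0 // ltW.
  apply: le_trans Tm_small; rewrite ler_wpM2l //; last by lra.
  by do 2 apply: mulr_ge0 => //; exact: mulr_ge0.
have h2 : K * (tau * S k.+1) <= delta / 4.
  apply: (@le_trans _ _ (K * (tau * (4 * `|G|)))).
    by rewrite ler_wpM2l // ler_wpM2l ?S_le // ltW.
  rewrite (_ : K * _ = (8 * (K * `|G|)) * (delta / L)); last first.
    by rewrite /tau; field; rewrite gt_eqF.
  have GL : 32 * (K * `|G|) <= L.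
    by have := K0_gt0; have := c_ge0; rewrite /L mulrA; lra.
  have -> : delta / 4 = (L / 4) * (delta / L) by field; rewrite gt_eqF.
  by rewrite ler_wpM2r ?divr_ge0 //; [exact: ltW|lra].
have -> : delta / 2 = delta / 4 + delta / 4 by field.
by rewrite mulrDr lerD.
Qed.

End interval.

(** The bound [K0] on [w] holds to begin with, and it can be halved forever on
    an interval whose length depends on neither the bound nor [a]. *)
Lemma comparison_short_time : exists2 T0, 0 < T0 <= 1 &
  forall a, 0 <= a -> a + T0 + 2 <= H ->
    {ae mu, forall x, D x -> w a x <= 0} ->
    forall t, a <= t <= a + T0 -> {ae mu, forall x, D x -> w t x <= 0}.
Proof.
have [Cl Cl0 f_Cl] := f_lip L.
have KCm : 0 <= 4 * (K * Cl * m) by rewrite mulr_ge0 // mulr_ge0 // mulr_ge0.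
exists (4 * (K * Cl * m) + 1)^-1.
  by rewrite invr_gt0 ltr_wpDl //= invf_le1 ?ltr_wpDl // lerDr.
set T0 := _^-1; have T00 : 0 < T0 by rewrite invr_gt0 ltr_wpDl.
have T0_small : 4 * (K * Cl * m) * T0 <= 1.
  by rewrite ler_pdivrMr ?ltr_wpDl // mul1r lerDl.
move=> a a0 aTH wa.
have halving k t : a <= t <= a + T0 ->
    {ae mu, forall x, D x -> w t x <= K0 / 2 ^+ k}.
  elim: k t => [|k IH] t taT.
    have [a_t tT] := andP taT.
    have := L1_linear_decay mD Dfin dw a0 a_t.
    move=> /(_ K0 _)/filterS2; apply; last exact: wa; last first.
      move=> s /andP[as_ st]; apply: w'_bound; rewrite (le_trans a0) //=.
      by apply: le_trans st _; apply: le_trans aTH; apply: le_trans tT _; lra.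
    move=> x wt wax Dx; rewrite expr0 divr1.
    have := wt Dx; have := wax Dx; have := expR_gt0 (t - a).
    by have := K0_gt0; nra.
  have h2 : 0 < K0 / 2 ^+ k by rewrite divr_gt0 // exprn_gt0.
  rewrite exprSr invfM mulrA.
  apply: (@halved_bound a T0 (K0 / 2 ^+ k) Cl) => //; first exact: ltW.
  rewrite ler_pdivrMr ?exprn_gt0 // ler_peMr //; first exact: ltW.
  by rewrite exprn_ege1 // ler1n.
move=> t taT; have := ae_foralln (fun k => halving k t taT).
apply: filterS => x wk Dx; rewrite leNgt; apply/negP => w0.
pose k := (Num.truncn (K0 / w t x)).+1.
have : K0 / w t x < 2 ^+ k.
  apply: (lt_le_trans (truncnS_gt _)).
  by rewrite -natrX ler_nat ltnW // ltn_expl.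
rewrite ltr_pdivrMr // mulrC -ltr_pdivrMr ?exprn_gt0 //.
by rewrite ltNge wk.
Qed.

(** The length [T0] of the time step does not depend on where the step
    starts, so finitely many steps reach any time before the horizon. A step of
    length at most 1 also looks at [u] two grid intervals of length at most 1
    ahead; this is where the 3 comes from. *)
Lemma comparison : {ae mu, forall x, D x -> w 0 x <= 0} ->
  forall t, 0 <= t -> t + 3 <= H -> {ae mu, forall x, D x -> w t x <= 0}.
Proof.
move=> w0; have [T0 /andP[T00 T01] step] := comparison_short_time.
have reach k t : 0 <= t -> t + 3 <= H -> t <= k%:R * T0 ->
    {ae mu, forall x, D x -> w t x <= 0}.
  elim: k t => [|k IH] t t0 tH tk.
    by rewrite (_ : t = 0) //; apply/eqP; rewrite eq_le t0 -(mul0r T0) tk.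
  have [/IH|kt] := leP t (k%:R * T0); first exact.
  have kT0 : 0 <= k%:R * T0 by rewrite mulr_ge0 // ltW.
  apply: (step (k%:R * T0)) => //; [lra|apply: IH => //; lra|].
  by rewrite ltW //=; move: tk; rewrite -natr1 mulrDl mul1r.
move=> t t0 tH; apply: (reach (Num.truncn (t / T0)).+1) => //.
by rewrite -ler_pdivrMr // ltW // truncnS_gt.
Qed.

End comparison.

(** * Comparison for nonlocal equations *)

Section kernel_row.
Context d (T : measurableType d) (R : realType).
Variables (mu : {measure set T -> \bar R}) (D : set T).
Hypotheses (mD : measurable D) (Dfin : (mu D < +oo)%E).
Local Notation L1 f := (mu.-integrable D (EFin \o f)).
Variables (f : R -> R) (c1 c2 : R).
Hypothesis f_mono : {homo f : x y / x <= y}.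
Hypothesis f_growth : forall x, `|f x| <= c1 * `|x| + c2.
Variables (j : T -> R) (Jm : R).
Hypotheses (mj : measurable_fun setT j) (j_ge0 : forall y, 0 <= j y).
Hypothesis int_j : (\int[mu]_y (j y)%:E)%E = 1%E.
Hypotheses (Jm_ge0 : 0 <= Jm) (j_le : forall y, D y -> j y <= Jm).
Implicit Types v : T -> R.

Definition L1_extended v :=
  [/\ measurable_fun setT v, forall y, ~ D y -> v y = 0 & L1 v].

Let mf : measurable_fun setT f.
Proof. exact: nondecreasing_measurable. Qed.

Let ij : mu.-integrable setT (EFin \o j).
Proof.
apply/integrableP; split; first exact/measurable_EFinP.
by under eq_integral do rewrite /= ger0_norm //; rewrite int_j ltry.
Qed.

Let L1_restrict g : L1 g -> mu.-integrable setT (EFin \o (g \_ D)).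
Proof. by move=> /(integrable_mkcond _ mD); rewrite restrict_EFin. Qed.

Let L1_fv v : L1_extended v -> L1 (f \o v).
Proof.
by move=> [_ _ Iv]; exact: (L1_comp_linear_growth mD Dfin mf f_growth).
Qed.

(** Dominates [fun y => j y * f (v y)]: outside of [D], where [v] vanishes, the
    kernel may not be bounded but is integrable. *)
Let bound v : T -> R :=
  (fun y => Jm * `|f (v y)|) \_ D \+ (fun y => `|f 0| * j y).

Let ibound v : L1_extended v -> mu.-integrable setT (EFin \o bound v).
Proof.
move=> Ev; apply: L1D => //; last exact: L1Z.
by apply/L1_restrict/L1Z/L1_norm => //; exact: L1_fv.
Qed.

Let le_bound v y : L1_extended v -> `|j y * f (v y)| <= bound v y.
Proof.
move=> [_ v0 _]; rewrite /bound /= patchE normrM (ger0_norm (j_ge0 y)).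
case: ifPn => [|]; rewrite ?inE ?notin_setE => Dy.
  by rewrite ler_wpDr ?mulr_ge0 // ler_wpM2r // j_le.
by rewrite add0r v0 // mulrC.
Qed.

Lemma kernel_integrable v : L1_extended v ->
  mu.-integrable setT (EFin \o (fun y => j y * f (v y))).
Proof.
move=> Ev; apply: L1_dominated (ibound Ev) _ => [//||y _]; last exact: le_bound.
by apply: measurable_funM => //; apply: measurableT_comp => //; case: Ev.
Qed.

Lemma kernel_norm_le v : L1_extended v ->
  `|\int[mu]_y (j y * f (v y))| <=
  Jm * (c1 * (\int[mu]_(y in D) `|v y|) + c2 * fine (mu D)) + `|f 0|.
Proof.
move=> Ev; have Ij := kernel_integrable Ev.
apply: le_trans (le_normr_Rintegral measurableT Ij) _.
apply: (@le_trans _ _ (\int[mu]_y bound v y)).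
  apply: le_Rintegral => //; [exact: L1_norm|exact: ibound|].
  by move=> y _; exact: le_bound.
have [_ _ Iv] := Ev; have If := L1_fv Ev.
rewrite RintegralD //; last exact: L1Z; last first.
  by apply/L1_restrict/L1Z => //; exact: L1_norm.
rewrite RintegralZl // [X in `|f 0| * X](_ : _ = 1); last first.
  by rewrite /Rintegral int_j.
rewrite mulr1 lerD2r -Rintegral_mkcond RintegralZl //; last exact: L1_norm.
rewrite ler_wpM2l // -Rintegral_affine //.
by apply: le_Rintegral => //; [exact: L1_norm|exact: L1_affine].
Qed.

(** The two integrands agree outside of [D], and [j] is at most [Jm] on [D]. *)
Lemma kernel_increment_le v1 v2 delta : L1_extended v1 -> L1_extended v2 ->
  0 <= delta -> {ae mu, forall y, D y -> v1 y <= v2 y + delta} ->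
  \int[mu]_y (j y * f (v1 y)) - \int[mu]_y (j y * f (v2 y)) <=
  Jm * \int[mu]_(y in D) (f (v2 y + delta) - f (v2 y)).
Proof.
move=> E1 E2 delta0 v12.
have Id : L1 (fun y => f (v2 y + delta)).
  apply: (L1_comp_linear_growth mD Dfin mf f_growth).
  by apply: L1D => //; [case: E2|exact: L1_cst].
have If2 : L1 (fun y => f (v2 y)) by exact: L1_fv.
have Iinc := L1B mD Id If2.
rewrite -RintegralB //; [|exact: kernel_integrable..].
rewrite -RintegralZl // [leRHS]Rintegral_mkcond.
apply: ae_le_Rintegral => //.
- by apply: L1B => //; exact: kernel_integrable.
- by apply/L1_restrict/L1Z.
- apply: filterS v12 => y v12 _; rewrite patchE -mulrBr.
  case: ifPn => [|]; rewrite ?inE ?notin_setE => Dy; last first.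
    by have [_ -> //] := E1; have [_ -> //] := E2; rewrite subrr mulr0.
  have inc0 : 0 <= f (v2 y + delta) - f (v2 y).
    by rewrite subr_ge0 f_mono // lerDl.
  apply: (@le_trans _ _ (j y * (f (v2 y + delta) - f (v2 y)))).
    by rewrite ler_wpM2l // lerD2r f_mono // v12.
  by rewrite ler_wpM2r // j_le.
Qed.

End kernel_row.

Section nonlocal_comparison.
Context d (T : measurableType d) (R : realType).
Variables (mu : {measure set T -> \bar R}) (D : set T).
Hypotheses (mD : measurable D) (Dfin : (mu D < +oo)%E).
Variables (J : T -> T -> R) (Jm c1 c2 : R).
Hypotheses (Jm_ge0 : 0 <= Jm) (c1_ge0 : 0 <= c1) (c2_ge0 : 0 <= c2).
Hypothesis mJ : forall x, measurable_fun setT (J x).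
Hypothesis J_ge0 : forall x y, 0 <= J x y.
Hypothesis int_J : forall x, (\int[mu]_y (J x y)%:E)%E = 1%E.
Hypothesis J_le : forall x, D x -> forall y, D y -> J x y <= Jm.
Implicit Types (f g : R -> R) (u v : R -> T -> R).

Definition nonlocal f g v t x := - v t x + g (\int[mu]_y (J x y * f (v t y))).

(** The nonlocal term maps bounded sets of L^1 to bounded functions on [D], so
    that on a bounded time interval [g] is only evaluated in a bounded set,
    where it is Lipschitz. This gives the three bounds that [comparison]
    asks for. *)
Lemma subsolution_le f g u u' v v' :
  {homo f : x y / x <= y} -> {homo g : x y / x <= y} ->
  (forall x, `|f x| <= c1 * `|x| + c2) ->
  locally_lipschitz f -> locally_lipschitz g ->
  (forall t : R, 0 <= t -> L1_extended mu D (u t)) ->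
  (forall t : R, 0 <= t -> L1_extended mu D (v t)) ->
  L1_derivative mu D u u' -> L1_derivative mu D v v' ->
  (forall t : R, 0 <= t ->
    {ae mu, forall x, D x -> u' t x = nonlocal f g u t x}) ->
  (forall t : R, 0 <= t ->
    {ae mu, forall x, D x -> v' t x <= nonlocal f g v t x}) ->
  {ae mu, forall x, D x -> v 0 x <= u 0 x} ->
  forall t : R, 0 <= t -> {ae mu, forall x, D x -> v t x <= u t x}.
Proof.
move=> f_mono g_mono f_growth f_lip g_lip Eu Ev du dv u_eq v_le v0u0 t t0.
have H0 : 0 <= t + 3 by lra.
have [Bu uB] := L1_derivative_bounded mD du H0.
have [Bv vB] := L1_derivative_bounded mD dv H0.
pose B := Num.max Bu Bv; pose m := fine (mu D).
pose rho := Jm * (c1 * B + c2 * m) + `|f 0|.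
have [Cg Cg0 gC] := g_lip rho.
pose K (w : R -> T -> R) s x := \int[mu]_y (J x y * f (w s y)).
have Kbound (w : R -> T -> R) s x : L1_extended mu D (w s) ->
    \int[mu]_(y in D) `|w s y| <= B -> D x -> `|K w s x| <= rho.
  move=> Ew wB Dx; have := kernel_norm_le mD Dfin f_mono f_growth
    (mJ x) (J_ge0 x) (int_J x) Jm_ge0 (J_le Dx) Ew.
  move=> /le_trans; apply.
  by rewrite lerD2r ler_wpM2l // lerD2r ler_wpM2l.
have KuB s x : 0 <= s <= t + 3 -> D x -> `|K u s x| <= rho.
  move=> sH Dx; apply: Kbound => //; first by case/andP: sH => + _; exact: Eu.
  by rewrite le_max uB.
have KvB s x : 0 <= s <= t + 3 -> D x -> `|K v s x| <= rho.
  move=> sH Dx; apply: Kbound => //; first by case/andP: sH => + _; exact: Ev.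
  by rewrite le_max vB // orbT.
have rho0 s x : 0 <= s <= t + 3 -> D x -> 0 <= rho.
  by move=> sH Dx; apply: le_trans (KuB s x sH Dx).
pose c := `|g 0| + Cg * `|rho|.
have c0 : 0 <= c by rewrite addr_ge0 // mulr_ge0.
have g_le z : 0 <= rho -> `|z| <= rho -> `|g z| <= c.
  move=> r0 zr; rewrite -(subrK (g 0) (g z)) addrC.
  apply: le_trans (ler_normD _ _) _; rewrite lerD2l.
  apply: le_trans (gC z 0 zr _) _; first by rewrite normr0.
  by rewrite subr0 ler_wpM2l // (ger0_norm r0).
have dw := L1_derivativeB mD dv du.
suff : {ae mu, forall x, D x -> v t x - u t x <= 0}.
  by apply: filterS => x + Dx => /(_ Dx); rewrite subr_le0.
apply: (@comparison _ T R mu D mD Dfin f c1 c2 c1_ge0 c2_ge0 f_mono f_growth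
  f_lip u u' (fun t x => v t x - u t x) (fun t x => v' t x - u' t x) du dw
  (t + 3) B c (2 * c + 1) (Cg * Jm)) => //.
- by lra.
- by rewrite mulr_ge0.
- by move=> s sH; rewrite le_max uB.
- move=> s sH; have s0 : 0 <= s by case/andP: sH.
  apply: filterS (u_eq s s0) => x + Dx => -> //.
  rewrite /nonlocal addrAC addNr add0r.
  by apply: g_le; [exact: rho0 sH Dx|exact: KuB].
- move=> s sH; have s0 : 0 <= s by case/andP: sH.
  apply: filterS2 (u_eq s s0) (v_le s s0) => x ux vx Dx.
  have := vx Dx; rewrite (ux Dx) /nonlocal -/(K u s x) -/(K v s x).
  have := g_le _ (rho0 s x sH Dx) (KuB s x sH Dx).
  have := g_le _ (rho0 s x sH Dx) (KvB s x sH Dx).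
  by rewrite !ler_norml => /andP[? ?] /andP[? ?]; lra.
- move=> s delta sH delta0 w_delta; have s0 : 0 <= s by case/andP: sH.
  have vu : {ae mu, forall y, D y -> v s y <= u s y + delta}.
    by apply: filterS w_delta => y + Dy => /(_ Dy); rewrite lerBlDl.
  apply: filterS2 (u_eq s s0) (v_le s s0) => x ux vx Dx.
  have := vx Dx; rewrite (ux Dx) /nonlocal -/(K u s x) -/(K v s x).
  set I := \int[mu]_(y in D) _.
  have I0 : 0 <= I.
    by apply: Rintegral_ge0 => y _; rewrite subr_ge0 f_mono // lerDl.
  have Kvu : K v s x - K u s x <= Jm * I.
    exact: (kernel_increment_le mD Dfin f_mono f_growth (mJ x) (J_ge0 x)
      (int_J x) (J_le Dx) (Ev s s0) (Eu s s0)
      delta0 vu).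
  suff : g (K v s x) - g (K u s x) <= Cg * Jm * I by lra.
  rewrite -mulrA; have [uv|vu'] := leP (K u s x) (K v s x); last first.
    apply: (@le_trans _ _ 0); last by rewrite !mulr_ge0.
    by rewrite subr_le0 g_mono // ltW.
  apply: (@le_trans _ _ (Cg * (K v s x - K u s x))); last by rewrite ler_wpM2l.
  have := gC _ _ (KvB s x sH Dx) (KuB s x sH Dx).
  rewrite (ger0_norm (_ : 0 <= K v s x - K u s x)) ?subr_ge0 //.
  by apply: le_trans; exact: ler_norm.
- by apply: filterS v0u0 => x + Dx => /(_ Dx); rewrite subr_le0.
Qed.

Lemma L1_extendedN (v : T -> R) :
  L1_extended mu D v -> L1_extended mu D (fun x => - v x).
Proof.
move=> [mv v0 Iv]; split; first exact: measurableT_comp.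
  by move=> y Dy; rewrite v0 ?oppr0.
exact: L1N.
Qed.

Lemma nonlocalN f g u t x : {homo f : x y / x <= y} ->
  (forall x, `|f x| <= c1 * `|x| + c2) -> L1_extended mu D (u t) -> D x ->
  nonlocal (fun z => - f (- z)) (fun z => - g (- z)) (fun s y => - u s y) t x
  = - nonlocal f g u t x.
Proof.
move=> f_mono f_growth Eu Dx; rewrite /nonlocal opprD opprK; congr (_ - g _).
have Ij := kernel_integrable mD Dfin f_mono f_growth
  (mJ x) (J_ge0 x) (int_J x) (J_le Dx) Eu.
transitivity (- \int[mu]_y (-1 * (J x y * f (u t y)))).
  by congr (- _); apply: eq_Rintegral => y _; rewrite opprK mulN1r mulrN.
by rewrite RintegralZl // mulN1r opprK.
Qed.

(** The equation is preserved when [u], [f] and [g] are replaced by [- u],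
    [fun z => - f (- z)] and [fun z => - g (- z)], and subsolutions become
    supersolutions. *)
Lemma supersolution_ge f g u u' v v' :
  {homo f : x y / x <= y} -> {homo g : x y / x <= y} ->
  (forall x, `|f x| <= c1 * `|x| + c2) ->
  locally_lipschitz f -> locally_lipschitz g ->
  (forall t : R, 0 <= t -> L1_extended mu D (u t)) ->
  (forall t : R, 0 <= t -> L1_extended mu D (v t)) ->
  L1_derivative mu D u u' -> L1_derivative mu D v v' ->
  (forall t : R, 0 <= t ->
    {ae mu, forall x, D x -> u' t x = nonlocal f g u t x}) ->
  (forall t : R, 0 <= t ->
    {ae mu, forall x, D x -> nonlocal f g v t x <= v' t x}) ->
  {ae mu, forall x, D x -> u 0 x <= v 0 x} ->
  forall t : R, 0 <= t -> {ae mu, forall x, D x -> u t x <= v t x}.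
Proof.
move=> f_mono g_mono f_growth f_lip g_lip Eu Ev du dv u_eq v_ge u0v0 t t0.
have lipN (k : R -> R) :
    locally_lipschitz k -> locally_lipschitz (fun z => - k (- z)).
  move=> klip r; have [C C0 kC] := klip r; exists C => // x y xr yr.
  rewrite -opprD normrN (le_trans (kC _ _ _ _)) ?normrN //.
  by rewrite -opprD normrN.
have monoN (k : R -> R) :
    {homo k : x y / x <= y} -> {homo (fun z => - k (- z)) : x y / x <= y}.
  by move=> kmono x y xy /=; rewrite lerN2; apply: kmono; rewrite lerN2.
suff : {ae mu, forall x, D x -> - v t x <= - u t x}.
  by apply: filterS => x + Dx => /(_ Dx); rewrite lerN2.
apply: (subsolution_le (monoN f f_mono) (monoN g g_mono) _ (lipN f f_lip)
  (lipN g g_lip) (u := fun t x => - u t x) (v := fun t x => - v t x)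
  _ _ (L1_derivativeN mD du) (L1_derivativeN mD dv))
  => // [x|s s0|s s0|s s0|s s0|].
- by rewrite normrN (le_trans (f_growth _)) // normrN.
- by apply: L1_extendedN; exact: Eu.
- by apply: L1_extendedN; exact: Ev.
- apply: filterS (u_eq s s0) => x + Dx => /(_ Dx) ->.
  by rewrite nonlocalN //; exact: Eu.
- apply: filterS (v_ge s s0) => x + Dx => /(_ Dx).
  by rewrite nonlocalN //=; [rewrite lerN2|exact: Ev].
- by apply: filterS u0v0 => x + Dx => /(_ Dx) /=; rewrite lerN2.
Qed.

End nonlocal_comparison.

(** * From L^p to L^1 *)

Section Lp_to_L1.
Context d (T : measurableType d) (R : realType).
Variables (mu : {measure set T -> \bar R}) (D : set T).
Hypotheses (mD : measurable D) (Dfin : (mu D < +oo)%E).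
Implicit Types w : T -> R.
Local Open Scope ereal_scope.

Let integral_le_hoelder r : (1 < r)%R -> exists2 C : R, (0 <= C)%R &
  forall w, measurable_fun setT w ->
  \int[mu]_(x in D) `|(w x)%:E| <= C%:E * 'N[mu]_r%:E[EFin \o w].
Proof.
move=> r1; pose q := ((1 - r^-1)^-1)%R.
have r0 : (0 < r)%R by rewrite (lt_trans _ r1).
have q0 : (0 < q)%R by rewrite invr_gt0 subr_gt0 invf_lt1.
have Nfin : 'N[mu]_q%:E[EFin \o \1_D] \is a fin_num.
  rewrite ge0_fin_numE ?Lnorm_ge0 // unlock /Lnorm; apply: poweR_lty.
  rewrite (eq_integral (fun x => (\1_D x)%:E)) => [|x _].
    by rewrite integral_indic // setIT.
  rewrite /= indicE; case: (x \in D) => /=; first by rewrite normr1 powR1.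
  by rewrite normr0 powR0 // gt_eqF.
exists (fine 'N[mu]_q%:E[EFin \o \1_D]); first by rewrite fine_ge0 ?Lnorm_ge0.
move=> w mw; rewrite fineK // muleC.
have := hoelder mu mw (measurable_indic mD) r0 q0.
have -> : (r^-1 + q^-1 = 1)%R by rewrite invrK addrC subrK.
move=> /(_ erefl); apply: le_trans; rewrite Lnorm1 integral_mkcond.
apply: ge0_le_integral => //=.
- by move=> x _; rewrite patchE; case: ifP.
- apply/(measurable_restrictT _ _).1 => //.
  by do 2 apply: measurableT_comp => //; apply: measurable_funTS.
- apply/measurable_EFinP; apply: measurableT_comp => //.
  by apply: measurable_funM.
- move=> x _; rewrite patchE indicE.
  case: (x \in D) => /=; first by rewrite mulr1.
  by rewrite lee_fin.
Qed.

(** This is Hoelder's inequality against the indicator of [D], which has a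
    finite norm for every exponent. *)
Lemma integral_le_Lnorm (p : \bar R) : 1 <= p -> exists2 C : R, (0 <= C)%R &
  forall w, measurable_fun setT w ->
  \int[mu]_(x in D) `|(w x)%:E| <= C%:E * 'N[mu]_p[EFin \o w].
Proof.
case: p => [r| |] //.
  rewrite lee_fin le_eqVlt => /predU1P[<-|]; last exact: integral_le_hoelder.
  exists 1%R => // w mw; rewrite mul1e Lnorm1.
  apply: ge0_subset_integral => //.
  by do 2 apply: measurableT_comp => //.
move=> _; exists (fine (mu D)); first exact: fine_ge0.
move=> w mw; rewrite fineK ?ge0_fin_numE // muleC.
have mNw : measurable_fun D (EFin \o w).
  by apply: measurable_funTS; exact/measurable_EFinP.
rewrite unlock /Lnorm; case: ifPn => [T0|]; last first.
  rewrite -leNgt => T0; rewrite mul0e.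
  rewrite (_ : \int[mu]_(x in D) _ = 0) //; apply: integral_abs_eq0 => //.
  apply/eqP; rewrite eq_le measure_ge0 andbT.
  by apply: le_trans T0; apply: le_measure; rewrite ?inE.
apply: integral_le_bound => //.
  rewrite -(ess_sup_cst (0 : \bar R) T0); apply: le_ess_sup.
  by apply: nearW => x /=; rewrite lee_fin.
by apply: filterS (ess_sup_inf.ess_sup_ge mu (abse \o (EFin \o w))) => x + _.
Qed.

End Lp_to_L1.

(** * Topology and measure on R^n *)

Section row_vectors.
Context {R : realType} {n : nat}.

Lemma measurable_box (a b : 'I_n -> R) :
  measurable [set v : 'rV[R]_n | forall i, v ord0 i \in `[a i, b i] ].
Proof.
have -> : [set v : 'rV[R]_n | forall i, v ord0 i \in `[a i, b i] ] =
    \bigcap_(i in [set: 'I_n]) (rV_coord i @^-1` [set` `[a i, b i] ]).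
  by apply/seteqP; split=> v Bv i; [move=> _; exact: Bv|exact: Bv].
apply: fin_bigcap_measurable => // i _.
by rewrite -[X in measurable X]setTI; exact: measurable_rV_coord.
Qed.

(** An open set is the union of the closed boxes with rational centres and
    radii [k.+1^-1] that it contains. *)
Lemma open_measurable_rV (U : set 'rV[R]_n) : open U -> measurable U.
Proof.
move=> oU.
pose rad k : R := k.+1%:R^-1.
pose box (c : {ffun 'I_n -> rat}) (k : nat) := [set v : 'rV[R]_n | forall i,
  v ord0 i \in `[ratr (c i) - rad k, ratr (c i) + rad k] ].
have -> : U = \bigcup_(ck in [set ck : {ffun 'I_n -> rat} * nat |
    box ck.1 ck.2 `<=` U]) box ck.1 ck.2.
  apply/seteqP; split=> [v Uv|v [[c k] /= ckU ckv]]; last exact: ckU.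
  have /nbhs_ballP[e /= e0 eU] : nbhs v U by exact: open_nbhs_nbhs.
  have [k ke] : exists k, rad k < e / 2.
    exists (Num.truncn (2 / e)); rewrite -[e / 2]invrK.
    by rewrite ltf_pV2 ?posrE ?invr_gt0 ?divr_gt0 // invf_div truncnS_gt.
  have k0 : (0 : R) < rad k by rewrite invr_gt0.
  have cP i : exists c : rat, `|v ord0 i - ratr c| <= rad k.
    have /rat_in_itvoo[c] : v ord0 i - rad k < v ord0 i + rad k. by lra.
    rewrite in_itv /= => /andP[c1 c2]; exists c.
    by rewrite ler_norml; lra.
  pose c := [ffun i => xchoose (cP i)].
  have cE i : `|v ord0 i - ratr (c i)| <= rad k.
    by rewrite ffunE; exact: xchooseP (cP i).
  exists (c, k) => /= [z zc|i]; last first.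
    by have := cE i; rewrite in_itv /= ler_norml; lra.
  apply: eU; split => // i j; rewrite ord1.
  have := zc j; have := cE j; rewrite in_itv /= ler_norml /ball /= => ? ?.
  by rewrite ltr_norml; lra.
rewrite bigcup_mkcond; apply: countable_bigcupT_measurable => // ck.
by case: ifPn => // _; exact: measurable_box.
Qed.

Lemma continuous_measurable_rV (f : 'rV[R]_n -> R) :
  continuous f -> measurable_fun setT f.
Proof.
move=> cf; apply: (measurability (@RGenOpens.G R)) => [|/= _ [_] [a] [b] -> <-].
  exact: RGenOpens.measurableE.
rewrite setTI; apply: open_measurable_rV.
by move/continuousP: cf; apply; exact: interval_open.
Qed.

Lemma bounded_set_sub_box (A : set 'rV[R]_n) : bounded_set A ->
  exists2 r : R, 0 <= r & A `<=` [set v | forall i, v ord0 i \in `[- r, r] ].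
Proof.
move=> [M [_ AM]]; exists (`|M| + 1); first by rewrite addr_ge0.
move=> v Av i; rewrite in_itv /= -ler_norml.
have : `|v| <= `|M| + 1 by apply: AM => //; have := ler_norm M; lra.
apply: le_trans; rewrite [leRHS]/Num.norm /= mx_normrE.
exact: (@le_bigmax _ _ _ _ (fun ij : 'I_1 * 'I_n => `|v ij.1 ij.2|) (ord0, i)).
Qed.

Lemma bounded_set_leb (A : set 'rV[R]_n) :
  measurable A -> bounded_set A -> (leb n A < +oo)%E.
Proof.
move=> mA /bounded_set_sub_box[r r0 Ar].
apply: (@le_lt_trans _ _ (leb n [set v : 'rV[R]_n |
    forall i, v ord0 i \in `[- r, r] ])).
  by apply: le_measure => //; rewrite inE //; exact: measurable_box.
by rewrite leb_box ?ltry // => i; lra.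
Qed.

End row_vectors.

(** * The nonlocal evolution equation *)

Section phase_space.
Context {R : realType} {n : nat}.
Variables (Omega : set 'rV[R]_n) (p : \bar R).
Hypotheses (mOmega : measurable Omega) (Omega_fin : (leb n Omega < +oo)%E).
Hypothesis p_ge1 : (1 <= p)%E.

Lemma phase_space_L1_extended w :
  phase_space p Omega w -> L1_extended (leb n) Omega w.
Proof.
move=> [/andP[]]; rewrite !inE /= => mw Nw w0.
have mw' : measurable_fun setT w by [].
have [C C0 Cw] := integral_le_Lnorm mOmega Omega_fin p_ge1.
split=> //; apply/integrableP; split.
  by apply: measurable_funTS; exact/measurable_EFinP.
apply: le_lt_trans (Cw w mw') _.
by rewrite lte_mul_pinfty.
Qed.

(** On a set of finite measure, convergence in L^p implies convergence in
    L^1. *)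
Lemma C1_phase_space_L1_derivative v v' :
  C1_phase_space p Omega v v' -> L1_derivative (leb n) Omega v v'.
Proof.
move=> [Ev Ev' dv _].
have Iv t : 0 <= t -> (leb n).-integrable Omega (EFin \o v t).
  by move=> t0; case: (phase_space_L1_extended (Ev t t0)).
have Iv' t : 0 <= t -> (leb n).-integrable Omega (EFin \o v' t).
  by move=> t0; case: (phase_space_L1_extended (Ev' t t0)).
split=> // t t0; apply/cvgrPdist_lt => e e0.
have [C C0 Cw] := integral_le_Lnorm mOmega Omega_fin p_ge1.
have eC : 0 < e / (C + 1) by rewrite divr_gt0 // ltr_wpDl.
have nN : nbhs (0 : \bar R) [set y : \bar R | (y < (e / (C + 1))%:E)%E].
  apply: open_nbhs_nbhs; split; first exact: open_ereal_lt_ereal.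
  by rewrite /= lte_fin.
near=> s.
have [s0 _] : 0 <= s /\ s != t by near: s; exact: near_punctured_half_line.
have : (Xnorm p (fun x => (s - t)^-1 * (v s x - v t x) - v' t x)%R
    < (e / (C + 1))%:E)%E by near: s; exact: (dv t t0 _ nN).
set q := fun x : 'rV[R]_n => (s - t)^-1 * (v s x - v t x) - v' t x => Nq.
have mq : measurable_fun setT q.
  have [mvs _ _] := phase_space_L1_extended (Ev s s0).
  have [mvt _ _] := phase_space_L1_extended (Ev t t0).
  have [mv't _ _] := phase_space_L1_extended (Ev' t t0).
  apply: measurable_funB; last exact: mv't.
  apply: measurable_funM; first exact: measurable_cst.
  exact: (measurable_funB mvs mvt).
have Iq : (leb n).-integrable Omega (EFin \o q).
  apply: L1B => //; [|exact: Iv'].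
  by apply: L1Z => //; apply: L1B => //; exact: Iv.
rewrite sub0r normrN ger0_norm ?Rintegral_ge0 //.
rewrite -lte_fin fineK; last by apply: integrable_fin_num => //; exact: L1_norm.
apply: le_lt_trans (Cw q mq) _.
apply: (@le_lt_trans _ _ (C%:E * (e / (C + 1))%:E)%E).
  by rewrite lee_wpmul2l ?lee_fin //; exact: ltW.
rewrite -EFinM lte_fin mulrCA gtr_pMr // ltr_pdivrMr ?ltr_wpDl // mul1r.
by rewrite ltrDl.
Unshelve. all: by end_near. Qed.

End phase_space.

Section domain_and_kernel.
Context {R : realType} {n : nat}.
Variables (Omega : set 'rV[R]_n) (J : 'rV[R]_n -> 'rV[R]_n -> R).
Hypotheses (dom_Omega : bounded_smooth_domain Omega).
Hypotheses (kerJ : symmetric_probability_kernel J).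

Lemma domain_measurable : measurable Omega.
Proof. by have [_ oO _ _ _] := dom_Omega; exact: open_measurable_rV. Qed.

Lemma domain_leb_fin : (leb n Omega < +oo)%E.
Proof.
have [_ _ _ bO _] := dom_Omega.
by apply: bounded_set_leb => //; exact: domain_measurable.
Qed.

Lemma kernel_continuous : continuous (fun z : 'rV[R]_n * 'rV[R]_n => J z.1 z.2).
Proof.
by move=> z; apply: differentiable_continuous; case: kerJ => -[+ _] _ _ _ _.
Qed.

Lemma kernel_row_measurable x : measurable_fun setT (J x).
Proof.
apply: continuous_measurable_rV => y.
apply: (@continuous_comp _ _ _ (fun y => (x, y)) (fun z => J z.1 z.2) y).
  move=> P [[A B] /= [nA nB] AB].
  by apply: filterS nB => z Bz; apply: AB; split => //=; exact: nbhs_singleton.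
exact: kernel_continuous.
Qed.

Lemma kernel_bounded : exists2 Jm, 0 <= Jm &
  forall x, Omega x -> forall y, Omega y -> J x y <= Jm.
Proof.
have [[z Oz] _ _ bO _] := dom_Omega.
have [r _ Or] := bounded_set_sub_box bO.
pose K := [set v : 'rV[R]_n | forall i, v ord0 i \in `[- r, r] ].
have cK : compact K.
  apply: (@rV_compact R n (fun=> `[- r, r]%classic)) => i.
  exact: segment_compact.
have [z0 _ zmax] : exists2 c, c \in K `*` K & forall t, t \in K `*` K ->
    J t.1 t.2 <= J c.1 c.2.
  apply: compact_EVT_max; first by exists (z, z); split; exact: Or.
    exact: compact_setX.
  by apply: continuous_subspaceT; exact: kernel_continuous.
exists (J z0.1 z0.2); first by case: kerJ => _ + _ _ _; exact.
by move=> x Ox y Oy; apply: (zmax (x, y)); rewrite inE; split; exact: Or.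
Qed.

End domain_and_kernel.

Lemma lipschitz_locally {R : realType} (f : R -> R) (M : set R -> R) :
  (forall B : set R, bounded_set B -> (M B).-lipschitz_B f) ->
  locally_lipschitz f.
Proof.
move=> lipf r; pose B := [set x : R | `|x| <= r].
have bB : bounded_set B.
  exists r; split; first exact: num_real.
  by move=> a ra x Bx; exact: le_trans (ltW ra).
exists `|M B| => // x y xr yr.
have /= := lipf B bB (x, y) (conj xr yr) => /le_trans; apply.
by rewrite ler_wpM2r // ler_norm.
Qed.

Lemma locally_lipschitz_affine {R : realType} (g : R -> R) (a b : R) :
  locally_lipschitz g -> locally_lipschitz (fun z => g (a * z + b)).
Proof.
move=> glip r; have [C C0 gC] := glip (`|a| * r + `|b|).
have ab z : `|z| <= r -> `|a * z + b| <= `|a| * r + `|b|.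
  move=> zr; apply: le_trans (ler_normD _ _) _.
  by rewrite lerD2r normrM ler_wpM2l.
exists (C * `|a|) => [|x y xr yr]; first exact: mulr_ge0.
apply: le_trans (gC _ _ (ab x xr) (ab y yr)) _.
by rewrite -mulrA -normrM ler_wpM2l // (_ : _ - _ = a * (x - y)) //; ring.
Qed.

Theorem theorem5p2 (R : realType) (n : nat) (n_gt0 : (0 < n)%N)
  (Omega : set 'rV[R]_n) (dom_Omega : bounded_smooth_domain Omega)
  (J : 'rV[R]_n -> 'rV[R]_n -> R) (kerJ : symmetric_probability_kernel J)
  (h beta : R) (h_ge0 : 0 <= h) (beta_ge0 : 0 <= beta)
  (p : \bar R) (p_ge1 : (1 <= p)%E)
  (f g : R -> R)
  (k1 k2 c1 c2 : R) (k1_ge0 : 0 <= k1) (k2_ge0 : 0 <= k2)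
  (c1_ge0 : 0 <= c1) (c2_ge0 : 0 <= c2)
  (g_growth : forall x, `|g x| <= k1 * `|x| + k2)
  (f_growth : forall x, `|f x| <= c1 * `|x| + c2)
  (k1_beta_c1 : k1 * beta * c1 < 1)
  (g_derivable : forall x, derivable g x 1) (g_C1 : continuous (g^`())%classic)
  (k3 k4 : R) (k3_ge0 : 0 <= k3) (k4_ge0 : 0 <= k4)
  (dg_growth : forall x, `|(g^`())%classic x| <= k3 * `|x| + k4)
  (g_mono : {homo g : x y / x <= y}) (f_mono : {homo f : x y / x <= y})
  (N M : set R -> R)
  (g_lip : forall B : set R, bounded_set B -> (N B).-lipschitz_B g)
  (f_lip : forall B : set R, bounded_set B -> (M B).-lipschitz_B f)
  (u0 : 'rV[R]_n -> R) (u : R -> 'rV[R]_n -> R)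
  (sol_u : is_solution p Omega J beta h f g u0 u) :
  (forall v : R -> 'rV[R]_n -> R,
     is_subsolution p Omega J beta h f g u0 v ->
     forall t, 0 <= t -> {ae leb n, forall x, v t x <= u t x}) /\
  (forall V : R -> 'rV[R]_n -> R,
     is_supersolution p Omega J beta h f g u0 V ->
     forall t, 0 <= t -> {ae leb n, forall x, u t x <= V t x}).
Proof.
have mO := domain_measurable dom_Omega.
have Ofin := domain_leb_fin dom_Omega.
have [Jm Jm0 J_le] := kernel_bounded dom_Omega kerJ.
have mJ := kernel_row_measurable kerJ.
have [_ J_ge0 _ int_J _] := kerJ.
pose G z := g (beta * z + beta * h).
have G_mono : {homo G : x y / x <= y}.
  by move=> x y xy; apply: g_mono; rewrite lerD2r ler_wpM2l.
have G_lip : locally_lipschitz G.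
  by apply: locally_lipschitz_affine; exact: lipschitz_locally g_lip.
have f_lip' : locally_lipschitz f by exact: lipschitz_locally f_lip.
have extended w w' : C1_phase_space p Omega w w' ->
    forall t, 0 <= t -> L1_extended (leb n) Omega (w t).
  by move=> [+ _ _ _] t t0 => /(_ t t0); exact: phase_space_L1_extended.
have zero_outside w w' : C1_phase_space p Omega w w' ->
    forall t x, 0 <= t -> ~ Omega x -> w t x = 0.
  by move=> [+ _ _ _] t x t0 Ox => /(_ t t0)[_]; apply.
have [u_0 [u' Cu u_eq]] := sol_u.
have du := C1_phase_space_L1_derivative mO Ofin p_ge1 Cu.
have u_eq' t : 0 <= t ->
    {ae leb n, forall x, Omega x -> u' t x = nonlocal (leb n) J f G u t x}.
  move=> t0; apply: filterS (u_eq t t0) => x -> Ox.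
  by rewrite /Fop patchE mem_set.
split=> [v [v_0 [v' Cv v_le]] t t0|V [V_0 [V' CV V_ge]] t t0].
- have dv := C1_phase_space_L1_derivative mO Ofin p_ge1 Cv.
  have v0u0 : {ae leb n, forall x, Omega x -> v 0 x <= u 0 x}.
    by apply: filterS2 u_0 v_0 => x -> + Ox => /(_ Ox).
  have := subsolution_le mO Ofin Jm0 c1_ge0 c2_ge0 mJ J_ge0 int_J J_le
    f_mono G_mono f_growth f_lip' G_lip (extended _ _ Cu) (extended _ _ Cv)
    du dv u_eq' v_le v0u0 t0.
  apply: filterS => x vu; have [/vu//|Ox] := pselect (Omega x).
  by rewrite (zero_outside _ _ Cu) // (zero_outside _ _ Cv).
- have dV := C1_phase_space_L1_derivative mO Ofin p_ge1 CV.
  have u0V0 : {ae leb n, forall x, Omega x -> u 0 x <= V 0 x}.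
    by apply: filterS2 u_0 V_0 => x -> + Ox => /(_ Ox).
  have := supersolution_ge mO Ofin Jm0 c1_ge0 c2_ge0 mJ J_ge0 int_J J_le
    f_mono G_mono f_growth f_lip' G_lip (extended _ _ Cu) (extended _ _ CV)
    du dV u_eq' V_ge u0V0 t0.
  apply: filterS => x uV; have [/uV//|Ox] := pselect (Omega x).
  by rewrite (zero_outside _ _ Cu) // (zero_outside _ _ CV).
Qed.
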